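(* Let $M$ be the closed oriented $4$-manifold obtained by gluing $N_a\times S^1$ minus an open tubular neighbourhood of $T_1$ to $S^1\times N_a$ minus an open tubular neighbourhood of $T_2$, along the identification that covers $\phi: T_1\to T_2$ and uses the product framings, as described in the context ($M$ is a genus $2$ surface bundle over the torus whose monodromy is a Dehn twist in each of the two directions of the base, about disjoint curves). Then $M$ is a spin manifold.
   Context: Let $T^2$ be the torus with standard generating curves $a,b$, and let $\tau:T^2\to T^2$ be the Dehn twist about $a$, with $\tau_*(a)=a$, $\tau_*(b)=ab$, supported in an annular neighbourhood of a curve parallel to $a$. Let $D\subset T^2$ be a closed disc with centre $q$, disjoint from the support of $\tau$. Let $N_a$ be the mapping torus of $\tau$, i.e. $T^2\times[0,1]$ with its two ends identified by $\tau$, with projection $\pi: N_a\to S^1=[0,1]/(0\sim 1)$. As $\tau$ is the identity on $D$, $N_a$ contains the solid torus $D\times S^1$ (the image of $D\times[0,1]$), with core circle $\{q\}\times S^1$, mapped by $\pi$ onto $S^1$ via projection to the second factor. The manifold $N_a\times S^1$ is a torus bundle over $S^1\times S^1$ with projection $\pi\times\mathrm{id}$. It contains the section $T_1=\{((q,z_0),z_1)\}$ with tubular neighbourhood $(D\times S^1)\times S^1\cong D\times T^2$. Similarly $S^1\times N_a$ is a torus bundle over $S^1\times S^1$ with projection $\mathrm{id}\times\pi$. It contains the section $T_2=\{(z_0,(q,z_1))\}$ with tubular neighbourhood $S^1\times(D\times S^1)\cong D\times T^2$. In both cases the $T^2$ factor of $D\times T^2$ is the base, with coordinates $(z_0,z_1)$.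 Let $\phi:T_1\to T_2$, $\phi((q,z_0),z_1)=(z_0,(q,z_1))$, which commutes with the bundle projections. Remove the interiors of the two tubular neighbourhoods and glue the resulting boundaries $\partial D\times T^2$ by $(u,z_0,z_1)\mapsto(r(u),z_0,z_1)$, where $r:\partial D\to\partial D$ is a reflection, so that the gluing map is orientation-reversing, covers $\phi$, and commutes with the projections to $S^1\times S^1$. The result $M$ is a bundle over $S^1\times S^1$ with fibre the closed genus $2$ surface $T^2\# T^2$. *)

(* Defs.v *)
From HB Require Import structures.
From Stdlib Require Import Relation_Operators.
From mathcomp Require Import all_boot all_order all_algebra generic_quotient.
From mathcomp Require Import all_classical all_reals all_analysis.
Set Implicit Arguments.
Unset Strict Implicit.
Unset Printing Implicit Defensive.
Import Order.TTheory GRing.Theory Num.Theory numFieldNormedType.Exports.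
Local Open Scope classical_set_scope.
Local Open Scope ring_scope.
Local Open Scope quotient_scope.

(** * Quotients of topological spaces by generated equivalence relations *)

Section Quotient.
Variables (T : topologicalType) (S : T -> T -> Prop).

Definition gen_eq : rel T := fun x y => `[< clos_refl_sym_trans T S x y >].

Lemma gen_eq_refl : reflexive gen_eq.
Proof. by move=> x; apply/asboolP; exact: rst_refl. Qed.

Lemma gen_eq_sym : symmetric gen_eq.
Proof. by move=> x y; apply/asboolP/asboolP; exact: rst_sym. Qed.

Lemma gen_eq_trans : transitive gen_eq.
Proof. by move=> y x z /asboolP xy /asboolP yz; apply/asboolP; exact: rst_trans yz. Qed.

Definition gen_equiv : equiv_rel T := EquivRel gen_eq gen_eq_refl gen_eq_sym gen_eq_trans.

Definition quot : topologicalType := quotient_topology {eq_quot gen_equiv}.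

Definition cls (x : T) : quot := \pi_({eq_quot gen_equiv}) x.

End Quotient.

(** * Smooth maps and smooth manifolds *)

Fixpoint class_C (R : realType) (V W : normedModType R) (k : nat) (U : set V)
    (f : V -> W) : Prop :=
  if k is k'.+1 then
    (forall x, U x -> differentiable f x) /\
    (forall h : V, class_C k' U (fun x => 'D_h f x))
  else {within U, continuous f}.

Definition smooth (R : realType) (V W : normedModType R) (U : set V) (f : V -> W) :=
  forall k, class_C k U f.

Section Manifold.
Variables (R : realType) (M : topologicalType).
Local Notation E := 'rV[R]_4.

(** A chart is given by its inverse: an open set of R^4 and a parametrization
    of an open set of [M] by it. *)
Definition chart := (set E * (E -> M))%type.

Definition is_chart (c : chart) : Prop :=
  [/\ open c.1, {in c.1 &, injective c.2}, {within c.1, continuous c.2} &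
      forall W : set E, open W -> W `<=` c.1 -> open (c.2 @` W)].

Definition overlap (c d : chart) : set E := c.1 `&` c.2 @^-1` (d.2 @` d.1).

(** The coordinate change [d.2^-1 \o c.2], meaningful on [overlap c d]. *)
Definition transition (c d : chart) (v : E) : E :=
  xget 0 [set w | d.1 w /\ d.2 w = c.2 v].

Definition oriented_smooth_atlas (A : set chart) : Prop :=
  [/\ forall c, A c -> is_chart c,
      forall m : M, exists2 c, A c & (c.2 @` c.1) m &
      forall c d, A c -> A d ->
        smooth (overlap c d) (transition c d) /\
        forall v, overlap c d v -> 0 < \det ('J (transition c d) v)].

(** Second countability follows from compactness. *)
Definition closed_oriented_manifold (A : set chart) : Prop :=
  [/\ hausdorff_space M, compact [set: M] & oriented_smooth_atlas A].

(** * Spin structures in dimension 4 *)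

Definition quat (a b c d : R) : E := \row_(i < 4) nth 0 [:: a; b; c; d] i.

Definition qmul (x y : E) : E :=
  quat (x 0 0 * y 0 0 - x 0 1 * y 0 1 - x 0 2 * y 0 2 - x 0 3 * y 0 3)
       (x 0 0 * y 0 1 + x 0 1 * y 0 0 + x 0 2 * y 0 3 - x 0 3 * y 0 2)
       (x 0 0 * y 0 2 - x 0 1 * y 0 3 + x 0 2 * y 0 0 + x 0 3 * y 0 1)
       (x 0 0 * y 0 3 + x 0 1 * y 0 2 - x 0 2 * y 0 1 + x 0 3 * y 0 0).

Definition qconj (x : E) : E := quat (x 0 0) (- x 0 1) (- x 0 2) (- x 0 3).

(** Spin(4) = Sp(1) x Sp(1). *)
Definition spin4 : set (E * E) :=
  [set s : E * E | \sum_(i < 4) s.1 0 i ^+ 2 = 1 /\ \sum_(i < 4) s.2 0 i ^+ 2 = 1].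

Definition spin_mul (s t : E * E) : E * E := (qmul s.1 t.1, qmul s.2 t.2).

(** The double covering Spin(4) -> SO(4) sends (p, q) to x |-> p x q^-1, here
    as a matrix acting on row vectors: its a-th row is the image of the a-th
    basis vector. *)
Definition spin_cover (s : E * E) : 'M[R]_4 :=
  lin1_mx (fun x : E => qmul (qmul s.1 x) (qconj s.2)).

(** A continuous positively oriented frame of the tangent bundle over the open
    set [U]: [e c v] is the matrix whose rows are the coordinates, in the chart
    [c], of the frame at the point [c.2 v]. *)
Definition frame_on (A : set chart) (U : set M) (e : chart -> E -> 'M[R]_4) : Prop :=
  [/\ forall c, A c -> {within c.1 `&` c.2 @^-1` U, continuous (e c)},
      forall c v, A c -> c.1 v -> U (c.2 v) -> 0 < \det (e c v) &
      forall c d v, A c -> A d -> overlap c d v -> U (c.2 v) ->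
        e d (transition c d v) = e c v *m 'J (transition c d) v].

(** A spin structure: a trivializing open cover of the tangent bundle whose
    transition functions take values in SO(4) (a reduction of the structure
    group) together with a lift of these to a Spin(4)-valued cocycle.  As
    [e k = e j . rho(s j k)] for a frame seen as an isomorphism from R^4, in
    row form [spin_cover (s j k)] multiplies on the left. *)
Definition has_spin_structure (A : set chart) : Prop :=
  exists (J : Type) (U : J -> set M) (e : J -> chart -> E -> 'M[R]_4)
         (s : J -> J -> M -> E * E),
  [/\ (forall j, open (U j)) /\ (forall m, exists j, U j m),
      forall j, frame_on A (U j) (e j),
      forall j k, {within U j `&` U k, continuous (s j k)} /\
                  (forall m, U j m -> U k m -> spin4 (s j k m)),
      forall j k c v, A c -> c.1 v -> U j (c.2 v) -> U k (c.2 v) ->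
        e k c v = spin_cover (s j k (c.2 v)) *m e j c v &
      forall j k l m, U j m -> U k m -> U l m ->
        s j l m = spin_mul (s j k m) (s k l m)].

Definition closed_spin_manifold (A : set chart) : Prop :=
  closed_oriented_manifold A /\ has_spin_structure A.

End Manifold.

(** * The torus, the Dehn twist and its mapping torus *)

Section MappingTorus.
Variables (R : realType) (f : R -> R).

Definition circle : topologicalType := quot (fun x y : R => y = x + 1).

Definition circ (x : R) : circle := cls (fun x y : R => y = x + 1) x.

Definition torus : topologicalType := (circle * circle)%type.

(** (x, y) |-> (x + f y, y), which is well defined when f (y + 1) = f y + 1. *)
Definition dehn_twist (p : torus) : torus :=
  (circ (repr p.1 + f (repr p.2)), p.2).

(** The curve [a] is x |-> (x, y0) and [b] is y |-> (x0, y).  Since [f]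
    increases by 1 across the annulus [al <= y <= be] and is constant (modulo
    1) elsewhere, [dehn_twist] is supported in this annulus and maps [b] to a
    curve homotopic to [ab]. *)
Definition twist_profile (al be : R) : Prop :=
  [/\ forall n x, derivable (derive1n n f) x 1,
      forall y, f (y + 1) = f y + 1,
      al < be /\ be < al + 1 &
      forall y, be - 1 <= y -> y <= al -> f y = 0].

Lemma circP (x y : R) : circ x = circ y <-> exists k : int, y = x + k%:~R.
Proof.
split=> [/eqP|[k ->]].
  rewrite /circ /cls => /eqP/eqmodP/asboolP; elim=> {x y}.
  - by move=> x y ->; exists 1.
  - by move=> x; exists 0; rewrite addr0.
  - by move=> x y _ [k ->]; exists (- k); rewrite mulrNz addrK.
  - by move=> x y z _ [k ->] _ [l ->]; exists (k + l); rewrite intrD addrA.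
have cN (n : nat) (z : R) : circ z = circ (z + n%:R).
  elim: n => [|n ->]; first by rewrite addr0.
  by apply/eqmodP/asboolP/rst_step; rewrite -addrA -natr1.
case: k => n; first exact: cN.
by rewrite NegzE mulrNz (cN n.+1 (x - _)) subrK.
Qed.

Lemma dehn_twistE (x y : R) : (forall z, f (z + 1) = f z + 1) ->
  dehn_twist (circ x, circ y) = (circ (x + f y), circ y).
Proof.
move=> f1; rewrite /dehn_twist /=; congr pair.
have fn (n : nat) z : f (z + n%:R) = f z + n%:R.
  by elim: n => [|n IH]; rewrite ?addr0 // -natr1 !addrA f1 IH.
have fk (k : int) z : f (z + k%:~R) = f z + k%:~R.
  case: k => n; first exact: fn.
  by rewrite NegzE mulrNz -[in RHS](subrK n.+1%:R z) fn addrK.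
have [k kE] : exists k : int, repr (circ x) = x + k%:~R.
  by apply/circP; rewrite [RHS]reprK.
have [l lE] : exists l : int, repr (circ y) = y + l%:~R.
  by apply/circP; rewrite [RHS]reprK.
apply/esym/circP; exists (k + l).
by rewrite kE lE fk intrD addrACA.
Qed.

(** The mapping torus: T^2 x R modulo the Z-action generated by
    (p, t + 1) ~ (tau p, t), for which T^2 x [0, 1] with its ends identified by
    tau is a fundamental domain. *)
Definition mapping_step (x y : torus * R) : Prop :=
  exists (p : torus) (t : R), x = (p, t + 1) /\ y = (dehn_twist p, t).

Definition Na : topologicalType := quot mapping_step.

Definition to_Na (p : torus) (t : R) : Na := cls mapping_step (p, t).

(** R^4 with coordinates (x, y, z0, z1), the first two on the fibre and the
    last two on the base, is the common universal covering of [Na * circle] and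
    [circle * Na]. *)
Definition fib (v : 'rV[R]_4) : torus := (circ (v 0 0), circ (v 0 1)).

Definition cov1 (v : 'rV[R]_4) : Na * circle :=
  (to_Na (fib v) (v 0 2), circ (v 0 3)).

Definition cov2 (v : 'rV[R]_4) : circle * Na :=
  (circ (v 0 2), to_Na (fib v) (v 0 3)).

End MappingTorus.

(** * The gluing *)

Section Gluing.
Variables (R : realType) (f : R -> R) (al be : R).
(** [D] is the round disc of centre (q1, q2) and radius [eps]; the reflection
    is u |-> w conj(u) in the complex notation, with w = w1 + i w2 of norm 1. *)
Variables (q1 q2 eps w1 w2 : R).
Local Notation E := 'rV[R]_4.

Definition open_disc : set (torus R) :=
  [set p | exists x y, (x - q1) ^+ 2 + (y - q2) ^+ 2 < eps ^+ 2 /\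
                       p = (circ x, circ y)].

Definition closed_disc : set (torus R) :=
  [set p | exists x y, (x - q1) ^+ 2 + (y - q2) ^+ 2 <= eps ^+ 2 /\
                       p = (circ x, circ y)].

(** The image of C x [0, 1] in the mapping torus, for C fixed by the twist. *)
Definition solid_torus (C : set (torus R)) : set (Na f) :=
  [set z | exists p t, C p /\ z = to_Na f p t].

Definition piece1 : set (Na f * circle R) := ~` (solid_torus open_disc `*` setT).
Definition piece2 : set (circle R * Na f) := ~` (setT `*` solid_torus open_disc).

Definition piece (b : bool) : topologicalType :=
  if b then (piece2 : topologicalType) else (piece1 : topologicalType).

Definition radius2 (v : E) : R := (v 0 0 - q1) ^+ 2 + (v 0 1 - q2) ^+ 2.

(** [(u, z0, z1) |-> (k r(u), z0, z1)], where u is measured from the centre. *)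
Definition reflect (k : R) (v : E) : E :=
  \row_(i < 4) nth 0
    [:: q1 + k * (w1 * (v 0 0 - q1) + w2 * (v 0 1 - q2));
        q2 + k * (w2 * (v 0 0 - q1) - w1 * (v 0 1 - q2));
        v 0 2; v 0 3] i.

Definition glue_step (x y : {b : bool & piece b}) : Prop :=
  exists (v : E) (z1 : piece1) (z2 : piece2),
  [/\ radius2 v = eps ^+ 2,
      val z1 = cov1 f v /\ val z2 = cov2 f (reflect 1 v),
      x = existT piece false z1 & y = existT piece true z2].

Definition glued : topologicalType := quot glue_step.

Definition is_point1 (m : glued) (z : Na f * circle R) : Prop :=
  exists2 z1 : piece1, val z1 = z & m = cls glue_step (existT piece false z1).

Definition is_point2 (m : glued) (z : circle R * Na f) : Prop :=
  exists2 z2 : piece2, val z2 = z & m = cls glue_step (existT piece true z2).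

(** The smooth structure near the common boundary comes from the product
    collars, in which the outer side of one boundary is matched with the inner
    side of the other one by (rho, theta) |-> (eps^2 / rho, r(theta)).  This
    map restricts to the gluing map for rho = eps and preserves orientation. *)
Definition invert (v : E) : E := reflect (eps ^+ 2 / radius2 v) v.

(** A neighbourhood of [D], embedded in the torus, and on which the twist is
    the identity. *)
Definition near_disc : set E :=
  [set v | `|v 0 0 - q1| < 2^-1 /\ be - 1 < v 0 1 < al].

Definition collar : set E :=
  [set v | radius2 v != 0 /\ near_disc v /\ near_disc (invert v)].

Definition glued_atlas : set (chart R glued) :=
  [set c | [/\ open c.1, {in c.1 &, injective c.2} &
    [\/ forall v, c.1 v ->
          ~ solid_torus closed_disc (cov1 f v).1 /\ is_point1 (c.2 v) (cov1 f v),
        forall v, c.1 v ->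
          ~ solid_torus closed_disc (cov2 f v).2 /\ is_point2 (c.2 v) (cov2 f v) |
        forall v, c.1 v -> collar v /\
          if eps ^+ 2 <= radius2 v then is_point1 (c.2 v) (cov1 f v)
          else is_point2 (c.2 v) (cov2 f (invert v))]]].

End Gluing.

Arguments glued_atlas {R}.

(* Main.v *)
Require Import Defs.
From mathcomp Require Import all_boot all_order all_algebra.
From mathcomp Require Import all_classical all_reals all_analysis.
From mathcomp Require Import lra.
Import Order.TTheory GRing.Theory Num.Theory numFieldNormedType.Exports.
Set Implicit Arguments.
Unset Strict Implicit.
Unset Printing Implicit Defensive.
Local Open Scope classical_set_scope.
Local Open Scope ring_scope.

(** [M] is shown to be parallelizable, so that the trivial lift of a global frame
    is a spin structure.  On each of the two pieces the deck transformations are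
    the maps (x, y, t) |-> (x + m + j f(y), y + n, t - j), and the frame
    d/dx, d/dy - t f'(y) d/dx, d/dz0, d/dz1 is invariant.  Near the removed disc
    it is the product frame.  In the collar, with u the complex coordinate of the
    fibre centred at the disc, the gluing map u |-> eps^2 w / u is holomorphic,
    and its derivative - eps^2 w / u^2 turns the second frame by u^2 with respect
    to the first, up to scaling and a constant rotation.  This loop winds twice
    around SO(2), hence is null-homotopic in SO(3): the rotation by u^2 extends to
    the map x |-> p x p on the quaternions, for which p = u can be moved to p = 1
    through nonzero elements a + b i + c j.

    All the geometry takes place in R^4.  The manifold is covered by the images of
    three open sets of R^4 (two copies of the complement of the discs and the
    collar), and the changes of coordinates are deck transformations composed with
    the inversion. *)

(** * Differentials and smooth maps *)

(** The winding number 2 is, up to sign, the Euler characteristic of the genus 2 fibre. It rules out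
    a frame with two vectors tangent to the fibres, and so forces the collar frame to tilt out of
    the fibre towards d/dz0; being even, it dies in pi_1(SO(3)) = Z/2, and this is where spin comes
    from. The frames of the pieces are only used off the discs of the larger radius [eps1]. This
    leaves an annulus of the collar for the contraction, and on both sides of it the collar frame
    equals the frame of the piece exactly, not just up to homotopy. Hence one global frame results.
    The atlas contains every compatible chart, and the maps from R^4 are only locally injective, so
    a point has many lifts and many coordinates. Each chart is therefore identified with a
    restriction of one of three maps from R^4, each coincidence of two of these maps with an
    explicit transformation, and the frame is checked against those transformations alone. *)

Section NearEq.
Variables (R : realType) (V W : normedModType R).

(** Serves to compare two maps with the same germ at [x]: their difference vanishes near [x]. *)
Lemma near0_is_diff (k : V -> W) (x : V) :
  (\near x, k x = 0) -> is_diff x k (fun=> 0).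
Proof.
move=> k0.
have kx : k x = 0 := nbhs_singleton k0.
have ko : k \o shift x = cst (k x) + (\0 : {linear V -> W}) +o_ (0 : V) id.
  apply/eqaddoP => e e0; near=> h.
  rewrite /= !fctE /= kx !addr0 subr0.
  suff -> : k (h + x) = 0 by rewrite normr0 mulr_ge0// ltW.
  by near: h; move: k0; rewrite (near_shift 0) subr0.
have k' : 'd k x = (fun=> 0) :> (V -> W).
  by apply: (diff_unique (df := \0)) => //; exact: cst_continuous.
apply: DiffDef => //; apply/diff_locallyP; rewrite k'; split; first exact: cst_continuous.
exact: ko.
Unshelve. all: by end_near. Qed.

Lemma near_eq_is_diff (f g : V -> W) (x : V) : (\near x, f x = g x) ->
  differentiable g x -> differentiable f x /\ 'd f x = 'd g x :> (V -> W).
Proof.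
move=> fg dg.
have := @near0_is_diff (f - g) x; case.
  by near=> z; rewrite !fctE (near fg z)// subrr.
move=> dfg dE.
have fE : f = (f - g) + g by rewrite subrK.
split; first by rewrite fE; exact: differentiableD.
rewrite fE diffD// dE; by apply/funext => z; exact: add0r.
Unshelve. all: by end_near. Qed.

End NearEq.

Lemma near_eq_continuous (T U : topologicalType) (f g : T -> U) (x : T) :
  (\near x, f x = g x) -> {for x, continuous g} -> {for x, continuous f}.
Proof.
move=> fg cg; change (f @ x --> f x); rewrite (nbhs_singleton fg).
by apply: cvg_trans cg; apply: near_eq_cvg; apply: filterS fg => y ->.
Qed.

Section MatrixContinuity.
Variables (R : realType) (T : topologicalType) (m n : nat).

Lemma mx_continuousP (f : T -> 'M[R]_(m, n)) (x : T) :
  {for x, continuous f} <-> forall i j, {for x, continuous (fun y => f y i j)}.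
Proof.
split=> [cf i j|cf].
  by apply: (@continuous_comp _ _ _ f (fun M : 'M[R]_(m, n) => M i j)) => //; exact: coord_continuous.
move=> A [P Pf PA]; suff : \forall y \near x, forall i j, P i j (f y i j).
  by apply: filterS => y Py; exact: PA.
apply: filter_forall => i; apply: filter_forall => j.
exact: cf.
Qed.

End MatrixContinuity.

Section Jacobian.
Variable R : realType.
Local Notation E := 'rV[R]_4.

Lemma mul_jacobian (f : E -> E) (x h : E) : h *m 'J f x = 'd f x h.
Proof. by rewrite /jacobian mul_rV_lin1. Qed.

Lemma jacobian_coef (f : E -> E) (x : E) i j : 'J f x i j = 'd f x (delta_mx 0 i) 0 j.
Proof. by rewrite mxE. Qed.

Lemma mulmx_rV_inj (A B : 'M[R]_4) : (forall h : E, h *m A = h *m B) -> A = B.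
Proof. by move=> AB; apply/row_matrixP => i; rewrite (rowE i A) (rowE i B) AB. Qed.

Lemma jacobian_near (f g : E -> E) (x : E) : (\near x, f x = g x) ->
  differentiable g x -> 'J f x = 'J g x.
Proof.
move=> fg dg; have [df dfg] := near_eq_is_diff fg dg.
apply/matrixP => i j; rewrite [LHS]jacobian_coef [RHS]jacobian_coef.
by move/(congr1 (fun F : E -> E => F (delta_mx 0 i) 0 j)): dfg.
Qed.

Lemma jacobian_comp (f g : E -> E) (x : E) :
  differentiable f x -> differentiable g (f x) ->
  'J (g \o f) x = 'J f x *m 'J g (f x).
Proof.
move=> df dg; apply: mulmx_rV_inj => h; rewrite mulmxA.
transitivity ('d (g \o f) x h); first exact: mul_jacobian.
rewrite diff_comp//; symmetry.
transitivity ('d f x h *m 'J g (f x)); last exact: mul_jacobian.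
by congr (_ *m _); exact: mul_jacobian.
Qed.

Lemma jacobianE (f : E -> E) (x : E) i j : differentiable f x ->
  'J f x i j = 'D_(delta_mx 0 i) (fun v => f v 0 j) x.
Proof.
move=> df; have dfi : derivable f x (delta_mx 0 i) by exact: diff_derivable.
by rewrite [LHS]jacobian_coef -deriveE// derive_mx// mxE.
Qed.

Lemma differentiable_rowP (f : E -> E) (x : E) :
  (forall j, differentiable (fun v => f v 0 j : R) x) -> differentiable f x.
Proof.
move=> df; have -> : f = \sum_(j < 4) (fun v => f v 0 j *: delta_mx 0 j).
  by apply/funext => v; rewrite [LHS]row_sum_delta fct_sumE.
by apply: differentiable_sum => j; exact: differentiableZl.
Qed.

End Jacobian.

(** * Smoothness is a local property *)

Section SmoothMaps.
Variable R : realType.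

(** Iterated directional derivatives only see germs: if [(B, g)] is a witness for [f], then
    [(B, 'D_h g)] is one for ['D_h f]. This allows [transition], a choice of preimage, to be
    replaced by an explicit formula near each point. *)
Lemma class_C_local (V W : normedModType R) (k : nat) (U : set V) (f : V -> W) :
  (forall x, U x -> exists B (g : V -> W),
     [/\ open B, B x, {in B, f =1 g} & class_C k B g]) ->
  class_C k U f.
Proof.
elim: k f => [|k IH] f H /=.
  rewrite continuous_subspace_in => x /set_mem Ux.
  have [B [g [oB Bx fg Cg]]] := H x Ux.
  apply: continuous_subspaceT_for => //.
  have cg : {for x, continuous g}.
    by move: Cg; rewrite /= continuous_open_subspace//; apply; exact/mem_set.
  apply: near_eq_continuous cg.
  by near=> y; apply/fg/mem_set; near: y; exact: open_nbhs_nbhs.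
split=> [x Ux|h].
  have [B [g [oB Bx fg [dg _]]]] := H x Ux.
  apply: (near_eq_is_diff _ (dg x Bx)).1.
  by near=> y; apply/fg/mem_set; near: y; exact: open_nbhs_nbhs.
apply: IH => x Ux; have [B [g [oB Bx fg [_ Cg]]]] := H x Ux.
exists B, (fun y => 'D_h g y); split=> // [y /set_mem By|]; last exact: Cg.
apply: near_eq_derive.
by near=> z; apply/fg/mem_set; near: z; exact: open_nbhs_nbhs.
Unshelve. all: by end_near. Qed.

Lemma smooth_local (V W : normedModType R) (U : set V) (f : V -> W) :
  (forall x, U x -> exists B (g : V -> W),
     [/\ open B, B x, {in B, f =1 g} & smooth B g]) ->
  smooth U f.
Proof.
move=> H k; apply: class_C_local => x /H[B [g [oB Bx fg Cg]]].
by exists B, g; split=> //; exact: Cg.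
Qed.

Lemma smooth_differentiable (V W : normedModType R) (U : set V) (f : V -> W) x :
  smooth U f -> U x -> differentiable f x.
Proof. by move=> /(_ 1%N) [+ _]; apply. Qed.

(** The entries are coordinates of directional derivatives, which are differentiable because [f] is
    of class C^2. *)
Lemma smooth_jacobian_continuous (U : set 'rV[R]_4) (f : 'rV[R]_4 -> 'rV[R]_4) x :
  open U -> smooth U f -> U x -> {for x, continuous (fun v => 'J f v)}.
Proof.
move=> oU Cf Ux; apply/mx_continuousP => i j.
have [_ /(_ (delta_mx 0 i))[+ _]] := Cf 2%N => /(_ x Ux) /differentiable_continuous cD.
move/mx_continuousP : cD => /(_ 0 j) cD.
have JE y : U y -> 'J f y i j = ('D_(delta_mx 0 i) f y) 0 j.
  move=> Uy; have dfy := smooth_differentiable Cf Uy.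
  by rewrite jacobianE// derive_mx ?mxE//; exact: diff_derivable.
apply: near_eq_continuous cD.
by near=> y; apply: JE; near: y; exact: open_nbhs_nbhs.
Unshelve. all: by end_near. Qed.

End SmoothMaps.

(** * Smoothness and Jacobians of explicit formulas by reflection *)

Section Expressions.
Variables (R : realType) (f : R -> R).
Hypothesis f_smooth : forall n x, derivable (derive1n n f) x 1.
Local Notation E := 'rV[R]_4.

(** Reified functions, a class closed under directional derivatives. *)
Inductive expr :=
  | Cst of R
  | Coord of 'I_4
  | Der of nat & expr
  | Add of expr & expr
  | Mul of expr & expr
  | Inv of expr.

Fixpoint eval (e : expr) (v : E) : R :=
  match e with
  | Cst c => c
  | Coord i => v 0 i
  | Der n e => derive1n n f (eval e v)
  | Add e1 e2 => eval e1 v + eval e2 v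
  | Mul e1 e2 => eval e1 v * eval e2 v
  | Inv e => (eval e v)^-1
  end.

Fixpoint wf (e : expr) (v : E) : Prop :=
  match e with
  | Cst _ | Coord _ => True
  | Der _ e => wf e v
  | Add e1 e2 | Mul e1 e2 => wf e1 v /\ wf e2 v
  | Inv e => wf e v /\ eval e v != 0
  end.

Fixpoint der (h : E) (e : expr) : expr :=
  match e with
  | Cst _ => Cst 0
  | Coord i => Cst (h 0 i)
  | Der n e => Mul (Der n.+1 e) (der h e)
  | Add e1 e2 => Add (der h e1) (der h e2)
  | Mul e1 e2 => Add (Mul (der h e1) e2) (Mul e1 (der h e2))
  | Inv e => Mul (Mul (Cst (-1)) (Mul (Inv e) (Inv e))) (der h e)
  end.

(** Differentiation creates no new denominators, so derivatives of every order are defined on the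
    same set; the induction in [evalr_smooth] rests on this. *)
Lemma wf_der h e v : wf e v -> wf (der h e) v.
Proof. by elim: e => //= [n e IH|e1 IH1 e2 IH2|e1 IH1 e2 IH2|e IH]; tauto. Qed.

Lemma eval_is_diff e v : wf e v ->
  differentiable (eval e) v /\ forall h, 'D_h (eval e) v = eval (der h e) v.
Proof.
elim: e => /= [c _|i _|n e IH /IH[de De]|e1 IH1 e2 IH2 [/IH1[d1 D1] /IH2[d2 D2]]|
  e1 IH1 e2 IH2 [/IH1[d1 D1] /IH2[d2 D2]]|e IH [/IH[de De] e0]].
- by split=> [|h]; [exact: differentiable_cst|rewrite derive_cst].
- have dc := differentiable_coord v 0 i; split=> // h.
  have di : derivable (id : E -> E) v h by exact: derivable_id.
  have := derive_mx di; rewrite derive_id => /matrixP /(_ 0 i).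
  by rewrite mxE => <-.
- have dn : differentiable (derive1n n f) (eval e v) by apply/derivable1_diffP.
  have dc : differentiable (derive1n n f \o eval e) v by exact: differentiable_comp.
  split=> // h; rewrite deriveE// diff_comp//= deriv1E//= -deriveE// De.
  by rewrite mulrC.
- split=> [|h]; first exact: differentiableD.
  by rewrite deriveD ?D1 ?D2//; exact: diff_derivable.
- split=> [|h]; first exact: differentiableM.
  rewrite deriveM; [|exact: diff_derivable..].
  by rewrite D1 D2 /GRing.scale/= addrC mulrC; congr (_ + _); rewrite mulrC.
- split=> [|h]; first exact: differentiableV.
  rewrite deriveV//; last exact: diff_derivable.
  by rewrite De /GRing.scale/= mulN1r expr2 invfM.
Qed.

Lemma expr_continuous e (g : E -> R) v : g =1 eval e -> wf e v -> {for v, continuous g}.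
Proof. by move=> /funext -> /eval_is_diff[/differentiable_continuous]. Qed.

Definition evalr (e : 'I_4 -> expr) (v : E) : E := \row_j eval (e j) v.

Lemma evalr_differentiable e v : (forall j, wf (e j) v) -> differentiable (evalr e) v.
Proof.
move=> we; apply: differentiable_rowP => j.
have [+ _] := eval_is_diff (we j); congr (differentiable _ _).
by apply/funext => x; rewrite mxE.
Qed.

Lemma derive_evalr e v h : (forall j, wf (e j) v) ->
  'D_h (evalr e) v = evalr (fun j => der h (e j)) v.
Proof.
move=> we; rewrite derive_mx; last exact/diff_derivable/evalr_differentiable.
apply/rowP => j; rewrite !mxE -(eval_is_diff (we j)).2.
by congr ('D_h _ v); apply/funext => x; rewrite mxE.
Qed.

Lemma evalr_smooth e (O : set E) : open O -> (forall v j, O v -> wf (e j) v) ->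
  smooth O (evalr e).
Proof.
move=> oO we k; elim: k e we => [|k IH] e we /=.
  apply: continuous_in_subspaceT => v /set_mem Ov.
  by apply/differentiable_continuous/evalr_differentiable => j; exact: we.
split=> [v Ov|h]; first by apply: evalr_differentiable => j; exact: we.
apply: class_C_local => v Ov.
exists O, (evalr (fun j => der h (e j))); split=> //.
  by move=> y /set_mem Oy; rewrite derive_evalr// => j; exact: we.
by apply: IH => y j Oy; apply/wf_der/we.
Qed.

Lemma jacobian_evalr e v : (forall j, wf (e j) v) ->
  'J (evalr e) v = \matrix_(i, j) eval (der (delta_mx 0 i) (e j)) v.
Proof.
move=> we; apply/matrixP => i j.
rewrite [RHS]mxE; transitivity ('D_(delta_mx 0 i) (fun v => evalr e v 0 j) v).
  exact/jacobianE/evalr_differentiable.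
have -> : (fun v => evalr e v 0 j) = eval (e j) by apply/funext => x; rewrite mxE.
by have [_] := eval_is_diff (we j); exact.
Qed.

End Expressions.

Arguments Coord {R}.

(** * The gluing data and the deck groups *)

(** [eps1] is the radius of an auxiliary larger disc, still off the support of
    the twist. *)
Record setup (R : realType) := Setup {
  prof : R -> R;
  al : R; be : R; q1 : R; q2 : R; eps : R; eps1 : R; w1 : R; w2 : R;
  prof_twist : twist_profile prof al be;
  eps_gt0 : 0 < eps;
  eps_lt : eps < eps1;
  disc_lo : be - 1 < q2 - eps1;
  disc_hi : q2 + eps1 < al;
  w_unit : w1 ^+ 2 + w2 ^+ 2 = 1 }.

Section Coordinates.
Variable R : realType.
Local Notation E := 'rV[R]_4.

Lemma quat0 (a b c d : R) : (quat a b c d) 0 0 = a. Proof. by rewrite mxE. Qed.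
Lemma quat1 (a b c d : R) : (quat a b c d) 0 1 = b. Proof. by rewrite mxE. Qed.
Lemma quat2 (a b c d : R) : (quat a b c d) 0 2 = c. Proof. by rewrite mxE. Qed.
Lemma quat3 (a b c d : R) : (quat a b c d) 0 3 = d. Proof. by rewrite mxE. Qed.

Definition quatE := (quat0, quat1, quat2, quat3).

Lemma ord4P (P : 'I_4 -> Prop) : P 0 -> P 1 -> P 2 -> P 3 -> forall i, P i.
Proof.
move=> P0 P1 P2 P3 [[|[|[|[|i]]]] // lti].
- by have -> : Ordinal lti = 0 by exact: val_inj.
- by have -> : Ordinal lti = 1 by exact: val_inj.
- by have -> : Ordinal lti = 2 by exact: val_inj.
- by have -> : Ordinal lti = 3 by exact: val_inj.
Qed.

Lemma rv4P (u v : E) : u 0 0 = v 0 0 -> u 0 1 = v 0 1 -> u 0 2 = v 0 2 ->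
  u 0 3 = v 0 3 -> u = v.
Proof. by move=> *; apply/rowP; exact: ord4P. Qed.

Lemma quat_eta (v : E) : quat (v 0 0) (v 0 1) (v 0 2) (v 0 3) = v.
Proof. by apply: rv4P; rewrite !quatE. Qed.

Lemma near_coord (v : E) (d : R) : 0 < d ->
  \forall w \near v, forall i : 'I_4, `|v 0 i - (w : E) 0 i| < d.
Proof.
move=> d0; exists (fun i j x => `|v i j - x| < d) => [i j|w H i]; last exact: H.
by apply/nbhs_ballP; exists d.
Qed.

Lemma near_notint (T : topologicalType) (g : T -> R) (x : T) :
  {for x, continuous g} -> g x \isn't a Num.int ->
  \forall y \near x, g y \isn't a Num.int.
Proof.
move=> cg gx.
have H : nbhs (g x) `](Num.floor (g x))%:~R, (Num.floor (g x) + 1)%:~R[%classic.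
  apply: open_nbhs_nbhs; split; first exact: interval_open.
  rewrite /= in_itv/= floorD1_gt andbT lt_neqAle floor_le andbT.
  by apply: contra gx => /eqP <-; exact: intr_int.
have gH : \forall y \near x, `](Num.floor (g x))%:~R, (Num.floor (g x) + 1)%:~R[%classic (g y) by exact: cg H.
apply: filterS gH => y /=; rewrite in_itv/= => /andP[ly uy].
apply/negP => /intrP[k kE]; move: ly uy; rewrite kE !ltr_int ltzD1 => fk /(lt_le_trans fk).
by rewrite ltxx.
Qed.

End Coordinates.

Notation isint x := (x \is a Num.int).

(** * The deck groups of the two coverings *)

Section Lattice.
Variables (R : realType) (G : setup R).
Local Notation E := 'rV[R]_4.
Local Notation f := (prof G).

Lemma al_lt_be : al G < be G. Proof. by have [_ _ []] := prof_twist G. Qed.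

(** The diameter fits into the gap from [be - 1] to [al], which is shorter than one period. *)
Lemma eps1_half : eps1 G < 2^-1.
Proof. have := disc_lo G; have := disc_hi G; have := al_lt_be; lra. Qed.

Lemma eps1_gt0 : 0 < eps1 G. Proof. exact: lt_trans (eps_gt0 G) (eps_lt G). Qed.

Lemma profD1 y : f (y + 1) = f y + 1. Proof. by have [_ ->] := prof_twist G. Qed.

Lemma prof0 y : be G - 1 <= y -> y <= al G -> f y = 0.
Proof. by have [_ _ _ f0] := prof_twist G; exact: f0. Qed.

Lemma prof_derivable n x : derivable (derive1n n f) x 1.
Proof. by have [fd _ _ _] := prof_twist G; exact: fd. Qed.

Lemma profDint y n : isint n -> f (y + n) = f y + n.
Proof.
have fn (m : nat) z : f (z + m%:R) = f z + m%:R.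
  by elim: m => [|m IH]; rewrite ?addr0 // -natr1 !addrA profD1 IH.
move=> /intrP[[m|m] ->]; first exact: fn.
by rewrite NegzE mulrNz -[in RHS](subrK m.+1%:R y) fn addrK.
Qed.

Lemma int_lt1 (x : R) : isint x -> `|x| < 1 -> x = 0.
Proof.
move=> /intrP[k ->]; rewrite -intr_norm -[1]/(1%:~R) ltr_int => k1.
by have /eqP -> : k == 0 by rewrite -normr_le0 -ltzD1 add0r.
Qed.

Definition tm (b : bool) (v : E) : R := if b then v 0 3 else v 0 2.

(** Equivalence under the deck group of [cov1] (for [b = false], where the
    fibre is twisted along the coordinate z0) or of [cov2].  The number of twists
    is written as [tm b v - tm b w], which makes the relation visibly closed. *)
Definition Gam (b : bool) (v w : E) : Prop :=
  [/\ isint (w 0 1 - v 0 1), isint (w 0 2 - v 0 2), isint (w 0 3 - v 0 3) &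
      isint (w 0 0 - v 0 0 - (tm b v - tm b w) * f (v 0 1))].

Definition intv (a : E) := forall i, isint (a 0 i).

(** The sign comes from [mapping_step]: (x, y, t + 1) ~ (x + f y, y, t), so raising t by one
    subtracts [f y] from x. *)
Definition deck (b : bool) (a v : E) : E :=
  quat (v 0 0 + a 0 0 - tm b a * f (v 0 1)) (v 0 1 + a 0 1) (v 0 2 + a 0 2)
       (v 0 3 + a 0 3).

Lemma tm_int b (v w : E) : isint (w 0 2 - v 0 2) -> isint (w 0 3 - v 0 3) ->
  isint (tm b v - tm b w).
Proof. by case: b => /= h2 h3; rewrite -opprB rpredN. Qed.

Lemma Gam_deck b a v : intv a -> Gam b v (deck b a v).
Proof.
move=> ia; rewrite /deck; split; [by rewrite !quatE addrC addKr..|].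
rewrite quatE.
have -> : tm b v - tm b (quat (v 0 0 + a 0 0 - tm b a * f (v 0 1)) (v 0 1 + a 0 1)
    (v 0 2 + a 0 2) (v 0 3 + a 0 3)) = - tm b a.
  by rewrite /tm; case: b; rewrite !quatE; lra.
have -> : v 0 0 + a 0 0 - tm b a * f (v 0 1) - v 0 0 - - tm b a * f (v 0 1) = a 0 0 by lra.
exact: ia.
Qed.

Lemma Gam_deckP b v w : Gam b v w -> exists2 a, intv a & w = deck b a v.
Proof.
move=> [h1 h2 h3 h0].
exists (quat (w 0 0 - v 0 0 - (tm b v - tm b w) * f (v 0 1)) (w 0 1 - v 0 1)
          (w 0 2 - v 0 2) (w 0 3 - v 0 3)).
  by apply: ord4P; rewrite quatE.
apply: rv4P; rewrite !quatE; [|lra..].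
have -> : tm b (quat (w 0 0 - v 0 0 - (tm b v - tm b w) * f (v 0 1)) (w 0 1 - v 0 1)
          (w 0 2 - v 0 2) (w 0 3 - v 0 3)) = tm b w - tm b v.
  by case: b h0 => h0; rewrite /tm quatE.
lra.
Qed.

Lemma Gam_refl b v : Gam b v v.
Proof. by split; rewrite !subrr ?mul0r ?subr0 ?rpred0. Qed.

(** The twists at [v] and at [w] use different values of [f]. These differ by the integer
    [w 0 1 - v 0 1], so the discrepancy, multiplied by the number of twists, is an integer shift of
    x. The same correction gives transitivity. *)
Lemma Gam_sym b v w : Gam b v w -> Gam b w v.
Proof.
move=> [h1 h2 h3 h0]; split; [by rewrite -opprB rpredN..|].
have -> : f (w 0 1) = f (v 0 1) + (w 0 1 - v 0 1) by rewrite -profDint// addrC subrK.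
have -> : v 0 0 - w 0 0 - (tm b w - tm b v) * (f (v 0 1) + (w 0 1 - v 0 1)) =
  - (w 0 0 - v 0 0 - (tm b v - tm b w) * f (v 0 1)) + (tm b v - tm b w) * (w 0 1 - v 0 1) by lra.
by apply: rpredD; [rewrite rpredN|apply: rpredM => //; exact: tm_int].
Qed.

Lemma Gam_trans b u v w : Gam b u v -> Gam b v w -> Gam b u w.
Proof.
move=> [h1 h2 h3 h0] [k1 k2 k3 k0]; split.
- by rewrite -(subrKA (v 0 1)) rpredD.
- by rewrite -(subrKA (v 0 2)) rpredD.
- by rewrite -(subrKA (v 0 3)) rpredD.
move: k0; have -> : f (v 0 1) = f (u 0 1) + (v 0 1 - u 0 1) by rewrite -profDint// addrC subrK.
move=> k0.
have -> : w 0 0 - u 0 0 - (tm b u - tm b w) * f (u 0 1) =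
  (v 0 0 - u 0 0 - (tm b u - tm b v) * f (u 0 1)) +
  (w 0 0 - v 0 0 - (tm b v - tm b w) * (f (u 0 1) + (v 0 1 - u 0 1))) +
  (tm b v - tm b w) * (v 0 1 - u 0 1) by lra.
apply: rpredD; first exact: rpredD.
by apply: rpredM => //; exact: tm_int.
Qed.

Lemma prof_continuous : continuous f.
Proof.
move=> x; have /derivable1_diffP := @prof_derivable 0%N x.
exact: differentiable_continuous.
Qed.

(** The relation says that four continuous functions of the pair take integer values, a closed
    condition. The Hausdorff property of the glued space comes down to this. *)
Lemma near_notGam b v w : ~ Gam b v w ->
  \forall p \near (v, w), ~ Gam b p.1 p.2.
Proof.
pose g0 (p : E * E) : R := p.2 0 0 - p.1 0 0 - (tm b p.1 - tm b p.2) * f (p.1 0 1).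
pose g i (p : E * E) : R := p.2 0 i - p.1 0 i.
have c1 i : continuous (fun p : E * E => p.1 0 i : R).
  move=> p; apply: (@continuous_comp _ _ _ fst (fun x : E => x 0 i)).
    exact: cvg_fst.
  exact: coord_continuous.
have c2 i : continuous (fun p : E * E => p.2 0 i : R).
  move=> p; apply: (@continuous_comp _ _ _ snd (fun x : E => x 0 i)).
    exact: cvg_snd.
  exact: coord_continuous.
have cg i : continuous (g i) by move=> p; apply: (@cvgB _ R^o); [exact: c2|exact: c1].
have ct1 : continuous (fun p : E * E => tm b p.1) by rewrite /tm; case: b {g0}; exact: c1.
have ct2 : continuous (fun p : E * E => tm b p.2) by rewrite /tm; case: b {g0 ct1}; exact: c2.
have cg0 : continuous g0.
  move=> p; apply: (@cvgB _ R^o); first exact: cg.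
  apply: cvgM; first by apply: (@cvgB _ R^o); [exact: ct1|exact: ct2].
  apply: (@continuous_comp _ _ _ (fun p : E * E => p.1 0 1) f); first exact: c1.
  exact: prof_continuous.
move=> nG.
have [h1|h1] := boolP (isint (g 1 (v, w))); last first.
  by apply: filterS (near_notint (cg 1 (v, w)) h1) => p /negP h [].
have [h2|h2] := boolP (isint (g 2 (v, w))); last first.
  by apply: filterS (near_notint (cg 2 (v, w)) h2) => p /negP h [].
have [h3|h3] := boolP (isint (g 3 (v, w))); last first.
  by apply: filterS (near_notint (cg 3 (v, w)) h3) => p /negP h [].
have [h0|h0] := boolP (isint (g0 (v, w))); last first.
  by apply: filterS (near_notint (cg0 (v, w)) h0) => p /negP h [].
by exfalso; apply: nG.
Qed.

(** Integers of absolute value below 1 vanish: first the shifts of y, z0 and z1, hence the number of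
    twists, and only then the shift of x. *)
Lemma Gam_ball b (v w : E) : (forall i, `|v 0 i - w 0 i| < 1) -> Gam b v w -> v = w.
Proof.
move=> vw [h1 h2 h3 h0].
have e i : isint (w 0 i - v 0 i) -> v 0 i = w 0 i.
  move=> hi; apply/esym/eqP; rewrite -subr_eq0; apply/eqP/int_lt1 => //.
  by rewrite distrC.
have t0 : tm b v - tm b w = 0 by rewrite /tm; case: b {h0}; rewrite e ?subrr.
by apply: rv4P; apply: e => //; move: h0; rewrite t0 mul0r subr0.
Qed.

Lemma Gam_box b (v : E) : exists2 w, Gam b v w & forall i, 0 <= w 0 i <= 1.
Proof.
pose fl (x : R) : R := (Num.floor x)%:~R.
have fli x : isint (fl x) by exact: intr_int.
pose a := quat 0 (- fl (v 0 1)) (- fl (v 0 2)) (- fl (v 0 3)).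
(* The first coordinate is reduced last, after the twist caused by reducing the base coordinate. *)
pose x := v 0 0 - tm b a * f (v 0 1).
exists (deck b (quat (- fl x) (a 0 1) (a 0 2) (a 0 3)) v).
  by apply: Gam_deck; apply: ord4P; rewrite !quatE rpredN.
have fl01 y : 0 <= y - fl y <= 1.
  by rewrite subr_ge0 floor_le/= lerBlDl -intrD1 ltW// floorD1_gt.
apply: ord4P; rewrite !quatE; [|exact: fl01..].
have -> : tm b (quat (- fl x) (- fl (v 0 1)) (- fl (v 0 2)) (- fl (v 0 3))) = tm b a.
  by rewrite /tm; case: (b); rewrite !quatE.
have -> : v 0 0 + - fl x - tm b a * f (v 0 1) = x - fl x by rewrite /x; lra.
exact: fl01.
Qed.

End Lattice.

(** * Lattice translates of the removed disc *)

Section Discs.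
Variables (R : realType) (G : setup R).
Local Notation E := 'rV[R]_4.
Local Notation f := (prof G).
Local Notation rad2 := (radius2 (q1 G) (q2 G)).
Local Notation nearD := (near_disc (al G) (be G) (q1 G)).

Definition lat (m n : R) (v : E) : E := quat (v 0 0 + m) (v 0 1 + n) (v 0 2) (v 0 3).

Definition off (r : R) : set E :=
  [set v | forall m n, isint m -> isint n -> r ^+ 2 < rad2 (lat m n v)].

(** The preimage of either piece of the gluing under its covering. *)
Definition Dc : set E :=
  [set v | forall m n, isint m -> isint n -> eps G ^+ 2 <= rad2 (lat m n v)].

Lemma rad2_lat (m n : R) (v : E) :
  rad2 (lat m n v) = (v 0 0 + m - q1 G) ^+ 2 + (v 0 1 + n - q2 G) ^+ 2.
Proof. by rewrite /radius2 /lat !quatE. Qed.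

Lemma lat0 v : lat 0 0 v = v.
Proof. by rewrite /lat !addr0 quat_eta. Qed.

Lemma lat_deck b m n v : lat m n v = deck G b (quat m n 0 0) v.
Proof. by rewrite /deck /tm; case: b; rewrite !quatE mul0r subr0 !addr0. Qed.

Lemma Gam_latP b v m n : isint m -> isint n -> Gam G b v (lat m n v).
Proof.
move=> im iN; rewrite (lat_deck b); apply: Gam_deck.
by apply: ord4P; rewrite quatE ?rpred0.
Qed.

Lemma sqr_le_norm (x y r : R) : 0 <= r -> x ^+ 2 + y ^+ 2 <= r ^+ 2 -> `|x| <= r /\ `|y| <= r.
Proof. by move=> r0 h; rewrite !ler_norml; split; apply/andP; split; nra. Qed.

Lemma rad2_le_norm (v : E) (r : R) : 0 <= r -> rad2 v <= r ^+ 2 ->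
  `|v 0 0 - q1 G| <= r /\ `|v 0 1 - q2 G| <= r.
Proof. exact: sqr_le_norm. Qed.

Lemma nearD_rad2 (v : E) : rad2 v <= eps1 G ^+ 2 -> nearD v.
Proof.
move=> /(rad2_le_norm (ltW (eps1_gt0 G)))[h0].
have := eps1_half G; have := disc_lo G; have := disc_hi G.
rewrite ler_norml => hi lo half /andP[l u]; split; first exact: le_lt_trans half.
by apply/andP; split; lra.
Qed.

Lemma nearD_f (v : E) : nearD v -> f (v 0 1) = 0.
Proof. by move=> [_ /andP[l u]]; apply: prof0; exact: ltW. Qed.

(** On this box [f] vanishes, so the points are related in the fibre by a lattice translation; the
    box has width 1 in x and less than 1 in y, so the translation is zero. *)
Lemma nearD_Gam b (v w : E) : nearD v -> nearD w -> Gam G b v w ->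
  w 0 0 = v 0 0 /\ w 0 1 = v 0 1.
Proof.
move=> nv nw [h1 _ _]; rewrite (nearD_f nv) mulr0 subr0 => h0.
move: nv nw; rewrite /near_disc/= !ltr_norml.
move=> [/andP[a1 a2] /andP[b1 b2]] [/andP[c1 c2] /andP[d1 d2]].
have := al_lt_be G => ab.
split; apply/eqP; rewrite -subr_eq0; apply/eqP/int_lt1 => //; rewrite ltr_norml;
  apply/andP; split; lra.
Qed.

Lemma nearD_lat (v : E) m n : nearD v -> isint m -> isint n ->
  rad2 (lat m n v) <= eps1 G ^+ 2 -> m = 0 /\ n = 0.
Proof.
move=> nv im iN /[dup] /nearD_rad2 nl _.
have [] := nearD_Gam nv nl (Gam_latP false v im iN).
by rewrite /lat quat0 quat1; split; lra.
Qed.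

(** For a point near the disc, no nontrivial translate enters the disc, and the infinitely many
    conditions of [Dc] reduce to one. *)
Lemma nearD_Dc (v : E) : nearD v -> Dc v <-> eps G ^+ 2 <= rad2 v.
Proof.
move=> nv; split=> [/(_ 0 0)|ev m n im iN]; first by rewrite lat0 rpred0; exact.
rewrite leNgt; apply/negP => h; move: (h).
have [|-> ->] := nearD_lat nv im iN; last by rewrite lat0 ltNge ev.
  apply: le_trans (ltW h) _; have := eps_gt0 G; have := eps_lt G; nra.
Qed.

Lemma nearD_off (v : E) r : r <= eps1 G -> 0 <= r -> nearD v -> off r v <-> r ^+ 2 < rad2 v.
Proof.
move=> re r0 nv; split=> [/(_ 0 0)|ev m n im iN]; first by rewrite lat0 rpred0; exact.
rewrite ltNge; apply/negP => h; move: (h).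
have [|-> ->] := nearD_lat nv im iN; last by rewrite lat0 leNgt ev.
  by apply: le_trans h _; nra.
Qed.

(** Deck transformations permute the translates of the disc. Indeed [f] vanishes at the height of
    the translated point, hence is an integer at the heights of [w] and [v], and the twist shifts x
    by an integer. *)
Lemma Gam_lat b (v w : E) m n : isint m -> isint n -> Gam G b v w ->
  rad2 (lat m n w) <= eps1 G ^+ 2 ->
  exists m' n', [/\ isint m', isint n' & rad2 (lat m' n' v) = rad2 (lat m n w)].
Proof.
move=> im iN [h1 h2 h3 h0] /nearD_rad2/nearD_f; rewrite /lat quatE profDint// => fw.
have fv : isint (f (v 0 1)).
  have -> : v 0 1 = w 0 1 + (v 0 1 - w 0 1) by lra.
  rewrite profDint; last by rewrite -opprB rpredN.
  have -> : f (w 0 1) = - n by lra.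
  by rewrite rpredD ?rpredN// -opprB rpredN.
have ih : isint (w 0 0 - v 0 0).
  rewrite -[_ - _](subrK ((tm b v - tm b w) * f (v 0 1))); apply: rpredD => //.
  by apply: rpredM => //; exact: tm_int.
exists (w 0 0 - v 0 0 + m), (w 0 1 - v 0 1 + n); split; [exact: rpredD..|].
by rewrite /radius2 !quatE; congr (_ ^+ 2 + _ ^+ 2); lra.
Qed.

Lemma eps_le_eps1 : eps G ^+ 2 < eps1 G ^+ 2.
Proof. have := eps_gt0 G; have := eps_lt G; nra. Qed.

Lemma Gam_Dc b (v w : E) : Gam G b v w -> Dc v -> Dc w.
Proof.
move=> vw dv m n im iN; rewrite leNgt; apply/negP => h.
have [m' [n' [im' in' e]]] := Gam_lat im iN vw (ltW (lt_trans h eps_le_eps1)).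
by move: (dv m' n' im' in'); rewrite e leNgt h.
Qed.

Lemma Gam_off b r (v w : E) : 0 <= r <= eps1 G -> Gam G b v w -> off r v -> off r w.
Proof.
move=> /andP[r0 r1] vw dv m n im iN; rewrite ltNge; apply/negP => h.
have [|m' [n' [im' in' e]]] := Gam_lat im iN vw.
  by apply: le_trans h _; nra.
by move: (dv m' n' im' in'); rewrite e ltNge h.
Qed.

Lemma off_Dc : off (eps G) `<=` Dc.
Proof. by move=> v h m n im iN; exact/ltW/h. Qed.

Lemma off1_off : off (eps1 G) `<=` off (eps G).
Proof. by move=> v h m n im iN; apply: lt_trans eps_le_eps1 _; exact: h. Qed.

Local Notation ev e := (@expr_continuous _ _ (@prof_derivable R G) e _ _).

Lemma rad2_lat_continuous m n : continuous (fun v => rad2 (lat m n v)).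
Proof.
move=> v.
pose u0 := Add (Add (Coord 0) (Cst m)) (Cst (- q1 G)).
pose u1 := Add (Add (Coord 1) (Cst n)) (Cst (- q2 G)).
by apply: (ev (Add (Mul u0 u0) (Mul u1 u1))) => // x; rewrite rad2_lat.
Qed.

Lemma rad2_continuous : continuous rad2.
Proof.
have -> : rad2 = (fun v => rad2 (lat 0 0 v)) by apply/funext => v; rewrite lat0.
exact: rad2_lat_continuous.
Qed.

Lemma round (x : R) : exists2 m, isint m & `|x + m| <= 2^-1.
Proof.
exists (- (Num.floor (x + 2^-1))%:~R); first by rewrite rpredN intr_int.
have := floor_le (x + 2^-1); have := floorD1_gt (x + 2^-1); rewrite intrD1 ler_norml.
by move=> *; apply/andP; split; lra.
Qed.

(* Only the lattice point nearest to [v] can be within [r < 1/2] of it. *)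
Lemma off_open r : 0 <= r < 2^-1 -> open (off r).
Proof.
move=> /andP[r0 r1]; rewrite openE => v ov.
have [m im hm] := round (v 0 0 - q1 G); have [n iN hn] := round (v 0 1 - q2 G).
have [d d0 dE] : exists2 d : R, 0 < d & d + r < 2^-1.
  by exists ((2^-1 - r) / 2); lra.
have near1 : \forall w \near v, r ^+ 2 < rad2 (lat m n w).
  by have /cvgr_gt := @rad2_lat_continuous m n v; apply; exact: ov.
near=> w => m' n' im' in'.
have /(_ _)/ltW wv : forall i : 'I_4, `|v 0 i - w 0 i| < d by near: w; exact: near_coord.
rewrite ltNge; apply/negP => h.
have : r ^+ 2 < rad2 (lat m n w) by near: w.
move: (h); rewrite !rad2_lat => /(sqr_le_norm r0)[].
move: (wv 0) (wv 1) hm hn; rewrite !ler_norml.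
move=> /andP[a1 a2] /andP[b1 b2] /andP[c1 c2] /andP[e1 e2] /andP[f1 f2] /andP[g1 g2].
have mm : m' = m.
  apply/eqP; rewrite -subr_eq0; apply/eqP/int_lt1; first exact: rpredB.
  by rewrite ltr_norml; apply/andP; split; lra.
have nn : n' = n.
  apply/eqP; rewrite -subr_eq0; apply/eqP/int_lt1; first exact: rpredB.
  by rewrite ltr_norml; apply/andP; split; lra.
by rewrite -rad2_lat -mm -nn ltNge h.
Unshelve. all: by end_near. Qed.

Lemma Dc_closed : closed Dc.
Proof.
have -> : Dc = \bigcap_(p in [set p : R * R | isint p.1 /\ isint p.2])
    [set v | eps G ^+ 2 <= rad2 (lat p.1 p.2 v)].
  by apply/seteqP; split=> v h => [[m n] [/= im iN]|m n im iN]; [exact: h|exact: (h (m, n))].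
apply: closed_bigI => -[m n] _ /=.
have c := @rad2_lat_continuous m n.
by apply: closed_comp (@closed_ge R (eps G ^+ 2)) => v _; exact: c.
Qed.

Lemma nearD_open : open nearD.
Proof.
have c : continuous (fun v : E => v 0 0 - q1 G : R^o).
  by move=> v; apply: (ev (Add (Coord 0) (Cst (- q1 G)))).
rewrite openE => v [h /andP[l u]].
have c0 := @coord_continuous _ _ _ 0 1 v.
near=> w; split; last apply/andP; last split; near: w.
- apply: (cvgr_lt (`|v 0 0 - q1 G|)) => //.
  apply: (@cvg_norm _ R^o); exact: c.
- exact: (cvgr_gt (v 0 1)).
- exact: (cvgr_lt (v 0 1)).
Unshelve. all: by end_near. Qed.

End Discs.

(** * The inversion, the deck transformations and their composites as smooth maps *)

Section LocalMaps.
Variables (R : realType) (G : setup R).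
Local Notation E := 'rV[R]_4.
Local Notation f := (prof G).
Local Notation rad2 := (radius2 (q1 G) (q2 G)).
Local Notation nearD := (near_disc (al G) (be G) (q1 G)).
Local Notation inv := (invert (q1 G) (q2 G) (eps G) (w1 G) (w2 G)).
Local Notation collarG := (collar (al G) (be G) (q1 G) (q2 G) (eps G) (w1 G) (w2 G)).
Local Notation expr := (expr R).

Lemma invE v : inv v =
  quat (q1 G + eps G ^+ 2 / rad2 v * (w1 G * (v 0 0 - q1 G) + w2 G * (v 0 1 - q2 G)))
       (q2 G + eps G ^+ 2 / rad2 v * (w2 G * (v 0 0 - q1 G) - w1 G * (v 0 1 - q2 G)))
       (v 0 2) (v 0 3).
Proof. by []. Qed.

Lemma rad2_inv v : rad2 (inv v) = (eps G ^+ 2 / rad2 v) ^+ 2 * rad2 v.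
Proof.
rewrite invE {1}/radius2 !quatE; set k := eps G ^+ 2 / _.
rewrite [in RHS]/radius2 -[RHS]mul1r -(w_unit G); lra.
Qed.

Lemma rad2_inv_mul v : rad2 v != 0 -> rad2 (inv v) * rad2 v = (eps G ^+ 2) ^+ 2.
Proof. by move=> v0; rewrite rad2_inv -mulrA -expr2 -exprMn divfK. Qed.

Lemma rad2_ge0 v : 0 <= rad2 v.
Proof. by rewrite addr_ge0// sqr_ge0. Qed.

Lemma rad2_gt0 v : rad2 v != 0 -> 0 < rad2 v.
Proof. by rewrite lt0r rad2_ge0 andbT. Qed.

Lemma rad2_inv_neq0 v : rad2 v != 0 -> rad2 (inv v) != 0.
Proof.
move=> v0; have := rad2_inv_mul v0; apply: contra_eq_neq => ->.
by rewrite mul0r eq_sym !expf_neq0// gt_eqF// eps_gt0.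
Qed.

(** The scale factors at [v] and at [inv v] have product 1, and the linear reflection squares to
    [w1 ^+ 2 + w2 ^+ 2 = 1]. *)
Lemma invK v : rad2 v != 0 -> inv (inv v) = v.
Proof.
move=> v0.
have kk : eps G ^+ 2 / rad2 (inv v) * (eps G ^+ 2 / rad2 v) = 1.
  rewrite mulf_div mulrC [rad2 (inv v) * _]rad2_inv_mul// -expr2 mulVf//.
  by rewrite !expf_neq0// gt_eqF// eps_gt0.
rewrite [LHS]invE; move: kk; set k' := eps G ^+ 2 / rad2 (inv v).
rewrite invE !quatE; set k := eps G ^+ 2 / rad2 v => kk.
have ww := w_unit G.
apply: rv4P; rewrite !quatE//.
- transitivity (q1 G + (k' * k) * (w1 G ^+ 2 + w2 G ^+ 2) * (v 0 0 - q1 G)); first lra.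
  by rewrite kk ww !mul1r addrC subrK.
- transitivity (q2 G + (k' * k) * (w1 G ^+ 2 + w2 G ^+ 2) * (v 0 1 - q2 G)); first lra.
  by rewrite kk ww !mul1r addrC subrK.
Qed.

Lemma inv2 v : (inv v) 0 2 = v 0 2. Proof. by rewrite invE quatE. Qed.
Lemma inv3 v : (inv v) 0 3 = v 0 3. Proof. by rewrite invE quatE. Qed.

Lemma rad2_xy (v w : E) : v 0 0 = w 0 0 -> v 0 1 = w 0 1 -> rad2 v = rad2 w.
Proof. by rewrite /radius2 => -> ->. Qed.

Lemma inv_xy (v w : E) : v 0 0 = w 0 0 -> v 0 1 = w 0 1 ->
  (inv v) 0 0 = (inv w) 0 0 /\ (inv v) 0 1 = (inv w) 0 1.
Proof. by move=> e0 e1; rewrite !invE !quatE (rad2_xy e0 e1) e0 e1. Qed.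

Lemma inv_circle v : rad2 v = eps G ^+ 2 -> inv v = Defs.reflect (q1 G) (q2 G) (w1 G) (w2 G) 1 v.
Proof.
by move=> v1; rewrite /invert v1 divff// expf_neq0// gt_eqF// eps_gt0.
Qed.

Lemma collar_inv v : collarG v -> collarG (inv v).
Proof. by move=> [v0 [nv niv]]; split; [exact: rad2_inv_neq0|rewrite invK]. Qed.

Lemma rad2_inv_le (v : E) (a b : R) : 0 < b -> a * b = (eps G ^+ 2) ^+ 2 ->
  b <= rad2 v -> rad2 (inv v) <= a.
Proof.
move=> b0 ab bv; have v0 : rad2 v != 0 by rewrite gt_eqF// (lt_le_trans b0).
have v1 := rad2_gt0 v0.
by rewrite -(ler_pM2r v1) rad2_inv_mul// -ab ler_wpM2l// -(ler_pM2r b0) mul0r ab sqr_ge0.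
Qed.

Lemma rad2_inv_ge (v : E) (a b : R) : 0 < b -> a * b = (eps G ^+ 2) ^+ 2 ->
  rad2 v != 0 -> rad2 v <= b -> a <= rad2 (inv v).
Proof.
move=> b0 ab v0 bv; have v1 := rad2_gt0 v0.
by rewrite -(ler_pM2r v1) rad2_inv_mul// -ab ler_wpM2l// -(ler_pM2r b0) mul0r ab sqr_ge0.
Qed.

Lemma rad2_inv_lt (v : E) : eps G ^+ 2 < rad2 v -> rad2 (inv v) < eps G ^+ 2.
Proof.
have e0 := eps_gt0 G => ev; have e1 : 0 < eps G ^+ 2 by rewrite exprn_gt0.
have v1 : 0 < rad2 v by exact: lt_trans ev.
by rewrite -(ltr_pM2r v1) rad2_inv_mul ?gt_eqF// (expr2 (eps G ^+ 2)) ltr_pM2l.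
Qed.

Lemma rad2_inv_gt (v : E) : rad2 v != 0 -> rad2 v < eps G ^+ 2 -> eps G ^+ 2 < rad2 (inv v).
Proof.
have e0 := eps_gt0 G => v0 ev; have e1 : 0 < eps G ^+ 2 by rewrite exprn_gt0.
have v1 := rad2_gt0 v0.
by rewrite -(ltr_pM2r v1) rad2_inv_mul// (expr2 (eps G ^+ 2)) ltr_pM2l.
Qed.

Definition sel4 (T : Type) (a b c d : T) (i : 'I_4) : T :=
  match val i with 0%N => a | 1%N => b | 2%N => c | _ => d end.

Lemma evalr_sel4 (a b c d : expr) v :
  evalr f (sel4 a b c d) v = quat (eval f a v) (eval f b v) (eval f c v) (eval f d v).
Proof. by apply: rv4P; rewrite !quatE mxE. Qed.

(** The argument [e] is an arbitrary tuple of expressions, as in [invertE], so that composites with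
    the inversion in either order are again expressions. *)
Definition deckE (b : bool) (a : E) (e : 'I_4 -> expr) : 'I_4 -> expr :=
  sel4 (Add (Add (e 0) (Cst (a 0 0))) (Mul (Cst (- tm b a)) (Der 0 (e 1))))
       (Add (e 1) (Cst (a 0 1))) (Add (e 2) (Cst (a 0 2))) (Add (e 3) (Cst (a 0 3))).

Definition u0E (e : 'I_4 -> expr) := Add (e 0) (Cst (- q1 G)).
Definition u1E (e : 'I_4 -> expr) := Add (e 1) (Cst (- q2 G)).
Definition rad2E (e : 'I_4 -> expr) :=
  Add (Mul (u0E e) (u0E e)) (Mul (u1E e) (u1E e)).
Definition scaleE (e : 'I_4 -> expr) := Mul (Cst (eps G ^+ 2)) (Inv (rad2E e)).

Definition invertE (e : 'I_4 -> expr) : 'I_4 -> expr :=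
  sel4 (Add (Cst (q1 G)) (Mul (scaleE e) (Add (Mul (Cst (w1 G)) (u0E e)) (Mul (Cst (w2 G)) (u1E e)))))
       (Add (Cst (q2 G)) (Mul (scaleE e) (Add (Mul (Cst (w2 G)) (u0E e)) (Mul (Cst (- w1 G)) (u1E e)))))
       (e 2) (e 3).

Lemma eval_deckE b a e v : evalr f (deckE b a e) v = deck G b a (evalr f e v).
Proof.
rewrite /deckE evalr_sel4 /deck /= !mxE /derive1n /=.
by congr (quat _ _ _ _); rewrite mulNr.
Qed.

Lemma eval_rad2E e v : eval f (rad2E e) v = rad2 (evalr f e v).
Proof. by rewrite /radius2 !mxE. Qed.

Lemma eval_invertE e v : evalr f (invertE e) v = inv (evalr f e v).
Proof.
rewrite /invertE evalr_sel4 invE /= -eval_rad2E !mxE /=.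
by congr (quat _ _ _ _); rewrite mulNr.
Qed.

Lemma evalr_Coord v : evalr f Coord v = v.
Proof. by apply/rowP => i; rewrite mxE. Qed.

Lemma deck_evalr b a : deck G b a = evalr f (deckE b a Coord).
Proof. by apply/funext => v; rewrite eval_deckE evalr_Coord. Qed.

Lemma inv_evalr : inv = evalr f (invertE Coord).
Proof. by apply/funext => v; rewrite eval_invertE evalr_Coord. Qed.

Lemma wf_deckE b a e v : (forall j, wf f (e j) v) -> forall j, wf f (deckE b a e j) v.
Proof. by move=> we; apply: ord4P; rewrite /deckE /=; intuition. Qed.

Lemma wf_invertE e v : (forall j, wf f (e j) v) -> rad2 (evalr f e v) != 0 ->
  forall j, wf f (invertE e j) v.
Proof.
move=> we r0; have := eval_rad2E e v => re.
apply: ord4P; rewrite /invertE /sel4; [| |exact: we..].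
  by rewrite /= -[_ + _]/(eval f (rad2E e) v) re; intuition.
by rewrite /= -[_ + _]/(eval f (rad2E e) v) re; intuition.
Qed.

Local Notation pd := (@prof_derivable R G).

Lemma deck_smooth b a : smooth setT (deck G b a).
Proof.
rewrite deck_evalr; apply: (evalr_smooth pd); first exact: openT.
by move=> v j _; apply: wf_deckE.
Qed.

Lemma rad2_open (g : E -> E) : continuous g -> open [set v | rad2 (g v) != 0].
Proof.
move=> cg; rewrite openE => v /= v0.
have c : {for v, continuous (fun v => rad2 (g v))}.
  by apply: continuous_comp; [exact: cg|exact: rad2_continuous].
have := rad2_gt0 v0 => v1.
have : \forall w \near v, 0 < rad2 (g w) by have := cvgr_gt _ c; apply.
by apply: filterS => w h; rewrite /= gt_eqF.
Qed.

Lemma inv_smooth : smooth [set v | rad2 v != 0] inv.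
Proof.
rewrite inv_evalr; apply: (evalr_smooth pd).
  by apply: (rad2_open (g := idfun)) => x.
by move=> v j v0; apply: wf_invertE => //; rewrite evalr_Coord.
Qed.

Lemma deck_differentiable b a v : differentiable (deck G b a) v.
Proof. exact: smooth_differentiable (deck_smooth b a) _. Qed.

Lemma deck_continuous b a : continuous (deck G b a).
Proof. by move=> v; exact/differentiable_continuous/deck_differentiable. Qed.

Lemma inv_differentiable v : rad2 v != 0 -> differentiable inv v.
Proof. exact: smooth_differentiable inv_smooth. Qed.

Lemma inv_continuous v : rad2 v != 0 -> {for v, continuous inv}.
Proof. by move=> v0; exact/differentiable_continuous/inv_differentiable. Qed.

Lemma deck_inv_smooth b a : smooth [set v | rad2 v != 0] (deck G b a \o inv).
Proof.
have -> : deck G b a \o inv = evalr f (deckE b a (invertE Coord)).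
  by apply/funext => v; rewrite eval_deckE eval_invertE evalr_Coord.
apply: (evalr_smooth pd); first by apply: (rad2_open (g := idfun)) => x.
by move=> v j v0; apply/wf_deckE/wf_invertE => //; rewrite evalr_Coord.
Qed.

Lemma inv_deck_smooth b a : smooth [set v | rad2 (deck G b a v) != 0] (inv \o deck G b a).
Proof.
have -> : inv \o deck G b a = evalr f (invertE (deckE b a Coord)).
  by apply/funext => v; rewrite eval_invertE eval_deckE evalr_Coord.
apply: (evalr_smooth pd); first exact/rad2_open/deck_continuous.
move=> v j v0; apply/wf_invertE; first exact: wf_deckE.
by rewrite eval_deckE evalr_Coord.
Qed.

Lemma collar_open : open collarG.
Proof.
have -> : collarG = [set v | rad2 v != 0] `&` (nearD `&` inv @^-1` nearD).
  by apply/seteqP; split=> v.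
rewrite openE => v [v0 [nv niv]].
have n1 : \forall w \near v, rad2 w != 0.
  by apply: open_nbhs_nbhs; split=> //; apply: (rad2_open (g := idfun)) => x.
have n2 : \forall w \near v, nearD w by apply: open_nbhs_nbhs; split => //; exact: nearD_open.
have n3 : \forall w \near v, nearD (inv w).
  apply: (inv_continuous v0); apply: open_nbhs_nbhs; split => //; exact: nearD_open.
by apply: filterS3 n1 n2 n3 => w; split.
Qed.

End LocalMaps.

(** * The coverings of the two pieces *)

Lemma pair_continuous_at (T U V : topologicalType) (g : T -> U) (h : T -> V) (x : T) :
  {for x, continuous g} -> {for x, continuous h} ->
  {for x, continuous (fun y => (g y, h y))}.
Proof. by move=> cg ch; exact: cvg_pair cg ch. Qed.

Section Covering.
Variables (R : realType) (G : setup R).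
Local Notation E := 'rV[R]_4.
Local Notation f := (prof G).
Local Notation odisc := (open_disc (q1 G) (q2 G) (eps G)).
Local Notation cdisc := (closed_disc (q1 G) (q2 G) (eps G)).

Lemma circ_surj (p : circle R) : exists x, p = circ x.
Proof. by exists (repr p); rewrite /circ /cls reprK. Qed.

Lemma circ_eq (x y : R) : circ x = circ y <-> isint (y - x).
Proof.
split=> [/circP[k ->]|/intrP[k kE]]; first by rewrite addrC addKr intr_int.
by apply/circP; exists k; rewrite -kE addrC subrK.
Qed.

Lemma fib_surj (p : torus R) (t z : R) : exists2 v : E, p = fib v & v 0 2 = t /\ v 0 3 = z.
Proof.
case: p => p q; have [x ->] := circ_surj p; have [y ->] := circ_surj q.
by exists (quat x y t z); rewrite /fib ?quatE.
Qed.

Lemma fib_eq (v w : E) : fib v = fib w <-> isint (w 0 0 - v 0 0) /\ isint (w 0 1 - v 0 1).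
Proof. by split=> [[/circ_eq h /circ_eq]|[h k]]//; congr pair; exact/circ_eq. Qed.

Definition na (x y t : R) : Na f := to_Na f (circ x, circ y) t.

(** The twist preserves y, so its iterates add multiples of the same number [f y]. *)
Lemma na_shift x y t n : isint n -> na x y (t + n) = na (x + n * f y) y t.
Proof.
have nat_shift (m : nat) z s : na z y (s + m%:R) = na (z + m%:R * f y) y s.
  elim: m z => [|m IH] z; first by rewrite mul0r !addr0.
  have step : na z y (s + m%:R + 1) = na (z + f y) y (s + m%:R).
    rewrite /na /to_Na /cls; apply/eqmodP/asboolP/Relation_Operators.rst_step.
    exists (circ z, circ y), (s + m%:R); split=> //.
    by rewrite dehn_twistE//; exact: profD1.
  rewrite -natr1 addrA step IH; congr (na _ _ _); lra.
move=> /intrP[[m|m] ->]; first exact: nat_shift.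
rewrite NegzE mulrNz -[in RHS](subrK m.+1%:R t) nat_shift.
by congr (na _ _ _); lra.
Qed.

(** [Na] is three-dimensional; the last coordinate is an inert label that lets [Gam] be reused. *)
Lemma to_Na_eq (v w : E) : v 0 3 = w 0 3 ->
  to_Na f (fib v) (v 0 2) = to_Na f (fib w) (w 0 2) <-> Gam G false v w.
Proof.
move=> vw3; split=> [|[h1 h2 h3 /= h0]]; last first.
  change (na (v 0 0) (v 0 1) (v 0 2) = na (w 0 0) (w 0 1) (w 0 2)).
  have -> : v 0 2 = w 0 2 + (v 0 2 - w 0 2) by rewrite addrC subrK.
  rewrite na_shift; last by rewrite -opprB rpredN.
  rewrite /na; congr (to_Na f (_, _) _); apply/circ_eq => //.
  by rewrite opprD addrA.
move=> /eqP; rewrite /to_Na /cls => /eqP/eqmodP/asboolP vw.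
(* The generated equivalence lives on the torus times R, [Gam] on R^4, so the induction quantifies
   over all lifts. In the transitive case the intermediate point is lifted with the same last
   coordinate. *)
pose S (P Q : torus R * R) := forall v w : E, P = (fib v, v 0 2) -> Q = (fib w, w 0 2) ->
  v 0 3 = w 0 3 -> Gam G false v w.
suff : S (fib v, v 0 2) (fib w, w 0 2) by apply.
elim: vw => {v w vw3} [P Q [p [t [-> ->]]]|P|P Q _ IH|P Q T _ IH1 _ IH2] v w.
- move=> eP eQ vw3.
  have [pv tv] := (congr1 fst eP : p = fib v, congr1 snd eP : t + 1 = v 0 2).
  have [pw tw] := (congr1 fst eQ : dehn_twist f p = fib w, congr1 snd eQ : t = w 0 2).
  move: pw; rewrite pv /fib dehn_twistE; last exact: profD1.
  move=> [/circ_eq h0 /circ_eq h1]; split=> //.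
  + have -> : w 0 2 - v 0 2 = - 1 by lra.
    by rewrite rpredN rpred1.
  + by rewrite vw3 subrr rpred0.
  + have -> : w 0 0 - v 0 0 - (tm false v - tm false w) * f (v 0 1) = w 0 0 - (v 0 0 + f (v 0 1)).
      by have -> : tm false v - tm false w = 1; rewrite /tm; lra.
    by [].
- move=> -> eP h3.
  have [/circ_eq h0 /circ_eq h1] := (congr1 fst eP : fib v = fib w).
  have h2 := (congr1 snd eP : v 0 2 = w 0 2); split=> //.
  + by rewrite h2 subrr rpred0.
  + by rewrite h3 subrr rpred0.
  + by rewrite /tm h2 subrr mul0r subr0.
- by move=> vP wQ h3; apply/Gam_sym/IH.
- move=> vP wQ h3; case: Q IH1 IH2 => q t IH1 IH2.
  have [u qu [u2 u3]] := fib_surj q t (v 0 3).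
  apply: (@Gam_trans _ _ _ _ u); first by apply: IH1; rewrite ?u3// qu u2.
  by apply: IH2; rewrite ?u3// qu u2.
Qed.

Lemma cov1_eq (v w : E) : cov1 f v = cov1 f w <-> Gam G false v w.
Proof.
pose v' := quat (v 0 0) (v 0 1) (v 0 2) 0; pose w' := quat (w 0 0) (w 0 1) (w 0 2) 0.
have := @to_Na_eq v' w'; rewrite /fib /v' /w' !quatE => /(_ erefl) tE.
split=> [[/tE[h1 h2 _ h0] /circ_eq h3]|[h1 h2 h3 h0]].
  by move: h1 h2 h0; rewrite /tm !quatE; split.
congr pair; last exact/circ_eq.
by apply/tE; split; rewrite /tm !quatE// subrr rpred0.
Qed.

(** Reduces to the same fact on [Na] by moving z1 into the third slot. *)
Lemma cov2_eq (v w : E) : cov2 f v = cov2 f w <-> Gam G true v w.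
Proof.
pose v' := quat (v 0 0) (v 0 1) (v 0 3) 0; pose w' := quat (w 0 0) (w 0 1) (w 0 3) 0.
have := @to_Na_eq v' w'; rewrite /fib /v' /w' !quatE => /(_ erefl) tE.
split=> [[/circ_eq h2 /tE[h1 h3 _ h0]]|[h1 h2 h3 h0]].
  by move: h1 h3 h0; rewrite /tm !quatE; split.
congr pair; first exact/circ_eq.
by apply/tE; split; rewrite /tm !quatE// subrr rpred0.
Qed.

Lemma cov1_surj (z : Na f * circle R) : exists v, z = cov1 f v.
Proof.
case: z => n c; have [[p t] <-] : exists p, cls (mapping_step f) p = n.
  by exists (repr n); rewrite /cls reprK.
have [z ->] := circ_surj c; have [v -> [vt vz]] := fib_surj p t z.
by exists v; rewrite /cov1 vt vz.
Qed.

Lemma cov2_surj (z : circle R * Na f) : exists v, z = cov2 f v.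
Proof.
case: z => c n; have [[p t] <-] : exists p, cls (mapping_step f) p = n.
  by exists (repr n); rewrite /cls reprK.
have [z ->] := circ_surj c; have [v -> [vz vt]] := fib_surj p z t.
by exists v; rewrite /cov2 vt vz.
Qed.

Lemma circ_continuous : continuous (@circ R).
Proof. exact: pi_continuous. Qed.

Lemma to_Na_continuous : continuous (cls (mapping_step f)).
Proof. exact: pi_continuous. Qed.

Lemma circ_coord_continuous i : continuous (fun v : E => circ (v 0 i)).
Proof. by move=> v; apply: continuous_comp; [exact: coord_continuous|exact: circ_continuous]. Qed.

Lemma fib_continuous : continuous (@fib R).
Proof.
move=> v.
have h := @pair_continuous_at _ _ _ _ _ v (@circ_coord_continuous 0 v) (@circ_coord_continuous 1 v).
exact h.
Qed.

Lemma to_Na_coord_continuous i : continuous (fun v : E => to_Na f (fib v) (v 0 i)).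
Proof.
move=> v; apply: (@continuous_comp _ _ _ (fun v : E => (fib v, v 0 i))); last exact: to_Na_continuous.
apply: (@pair_continuous_at _ _ _ (@fib R) (fun v : E => v 0 i)); last exact: coord_continuous.
exact: fib_continuous.
Qed.

Lemma cov1_continuous : continuous (cov1 f).
Proof.
move=> v.
have h := @pair_continuous_at _ _ _ _ _ v (@to_Na_coord_continuous 2 v) (@circ_coord_continuous 3 v).
exact h.
Qed.

Lemma cov2_continuous : continuous (cov2 f).
Proof.
move=> v.
have h := @pair_continuous_at _ _ _ _ _ v (@circ_coord_continuous 2 v) (@to_Na_coord_continuous 3 v).
exact h.
Qed.

(** Quotients by group actions are open maps: the preimage of an image is a union of translates. *)
Lemma circ_nbhs (x : R) (X : set R) : nbhs x X -> nbhs (circ x) (@circ R @` X).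
Proof.
move=> nX; apply: (@filterS _ _ _ (@circ R @` X^°)).
  by apply: image_subset; exact: interior_subset.
apply: open_nbhs_nbhs; split; last by exists x.
change (open (@circ R @^-1` (@circ R @` X^°))).
rewrite openE => y [z Xz /circ_eq yz].
have cy : {for y, continuous (fun y' : R => y' + (z - y) : R^o)}.
  by apply: (@cvgD _ R^o); [exact: cvg_id|exact: cvg_cst].
have nz : nbhs (y + (z - y)) X^° by rewrite addrC subrK; exact: nbhs_interior.
have cyz : \forall y' \near y, X^° (y' + (z - y)) by exact: (cy _ nz).
apply: (filterS _ cyz) => y' Xy'; exists (y' + (z - y)) => //.
by apply/circ_eq; rewrite opprD addrA subrr sub0r opprB.
Qed.

(** Openness is tested upstairs. If a point of the torus times R has its class in the image of the
    box, a deck transformation carries a lift of it into the box, and its continuity gives a product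
    neighbourhood, which [circ_nbhs] pushes down to the torus. *)
Lemma na_nbhs (x y t : R) (X Y T : set R) : nbhs x X -> nbhs y Y -> nbhs t T ->
  nbhs (na x y t) [set n | exists a b c, [/\ X a, Y b, T c & n = na a b c]].
Proof.
move=> nX nY nT.
pose S := [set n | exists a b c, [/\ X^° a, Y^° b, T^° c & n = na a b c]].
apply: (@filterS _ _ _ S).
  by move=> _ [a [b [c [/nbhs_singleton Xa /nbhs_singleton Yb /nbhs_singleton Tc ->]]]];
    exists a, b, c.
apply: open_nbhs_nbhs; split; last by exists x, y, t.
change (open (cls (mapping_step f) @^-1` S)).
rewrite openE => -[p s] [a [b [c [Xa Yb Tc pE]]]].
have [v pv [v2 v3]] := fib_surj p s 0.
pose w := quat a b c 0.
have /Gam_deckP[d id wE] : Gam G false v w.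
  by apply/to_Na_eq; rewrite ?v3 /fib /w ?quatE// -/(fib v) -pv v2; exact: pE.
have : nbhs (deck G false d v) [set u : E | [/\ X^° (u 0 0), Y^° (u 0 1) & T^° (u 0 2)]].
  rewrite -wE.
  have c0 := @coord_continuous R 1 4 0 0 w; have c1 := @coord_continuous R 1 4 0 1 w.
  have c2 := @coord_continuous R 1 4 0 2 w.
  have n0 : nbhs (w 0 0) X^° by rewrite quatE; exact: nbhs_interior.
  have n1 : nbhs (w 0 1) Y^° by rewrite quatE; exact: nbhs_interior.
  have n2 : nbhs (w 0 2) T^° by rewrite quatE; exact: nbhs_interior.
  have C0 : \forall u \near w, X^° ((u : E) 0 0) by exact: (c0 _ n0).
  have C1 : \forall u \near w, Y^° ((u : E) 0 1) by exact: (c1 _ n1).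
  have C2 : \forall u \near w, T^° ((u : E) 0 2) by exact: (c2 _ n2).
  by near=> u; split; near: u.
move=> /(@deck_continuous R G false d v)[P nP PS].
exists ((@circ R @` P 0 0) `*` (@circ R @` P 0 1), P 0 2) => /=.
  split; last by rewrite -v2; exact: nP.
  rewrite pv; exists (@circ R @` P 0 0, @circ R @` P 0 1) => //.
  by split; apply: circ_nbhs; exact: nP.
move=> [[_ _] s'] [[/= [a' Pa <-] [b' Pb <-]] Ps].
pose u := quat a' b' s' 0.
have [|X' Y' T'] := PS u.
  move=> i j; rewrite ord1; move: j; apply: ord4P; rewrite /u ?quatE//.
  by have := nbhs_singleton (nP 0 3); rewrite v3.
exists ((deck G false d u) 0 0), ((deck G false d u) 0 1), ((deck G false d u) 0 2); split=> //.
have d3 : d 0 3 = 0 by have := congr1 (fun u : E => u 0 3) wE; rewrite /deck !quatE v3 add0r.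
have uE : u 0 3 = (deck G false d u) 0 3 by rewrite /deck quatE d3 addr0.
by have := (to_Na_eq uE).2 (Gam_deck G false u id); rewrite /fib {1 2 3}/u !quatE.
Unshelve. all: by end_near. Qed.

Lemma cov1_nbhs (v : E) (W : set E) : nbhs v W -> nbhs (cov1 f v) (cov1 f @` W).
Proof.
move=> [P nP PW].
exists ([set n | exists a b c, [/\ P 0 0 a, P 0 1 b, P 0 2 c & n = na a b c]],
  @circ R @` P 0 3) => /=.
  by split; [apply: na_nbhs; exact: nP|apply: circ_nbhs; exact: nP].
move=> [_ _] [/= [a [b [c [Pa Pb Pc ->]]]] [d Pd <-]].
exists (quat a b c d); last by rewrite /cov1 /fib !quatE.
by apply: PW => i j; rewrite ord1; move: j; apply: ord4P; rewrite quatE.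
Qed.

Lemma cov2_nbhs (v : E) (W : set E) : nbhs v W -> nbhs (cov2 f v) (cov2 f @` W).
Proof.
move=> [P nP PW].
exists (@circ R @` P 0 2,
  [set n | exists a b c, [/\ P 0 0 a, P 0 1 b, P 0 3 c & n = na a b c]]) => /=.
  by split; [apply: circ_nbhs; exact: nP|apply: na_nbhs; exact: nP].
move=> [_ _] [/= [d Pd <-] [a [b [c [Pa Pb Pc ->]]]]].
exists (quat a b d c); last by rewrite /cov2 /fib !quatE.
by apply: PW => i j; rewrite ord1; move: j; apply: ord4P; rewrite quatE.
Qed.

Lemma odiscP (v : E) : odisc (fib v) <-> ~ Dc G v.
Proof.
split=> [[x [y [xy fE]]] dv|nd].
  have [] := (fib_eq v (quat x y 0 0)).1; first by rewrite fE /fib !quatE.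
  rewrite !quatE => h0 h1; have := dv _ _ h0 h1; rewrite rad2_lat.
  by rewrite (addrC (v 0 0)) (addrC (v 0 1)) !subrK leNgt xy.
apply: contrapT => no; apply: nd => m n im iN; rewrite leNgt; apply/negP => h; apply: no.
exists (v 0 0 + m), (v 0 1 + n); split; first by rewrite -rad2_lat.
by congr pair; apply/circ_eq; rewrite addrC addKr.
Qed.

Lemma cdiscP (v : E) : cdisc (fib v) <-> ~ off G (eps G) v.
Proof.
split=> [[x [y [xy fE]]] dv|nd].
  have [] := (fib_eq v (quat x y 0 0)).1; first by rewrite fE /fib !quatE.
  rewrite !quatE => h0 h1; have := dv _ _ h0 h1; rewrite rad2_lat.
  by rewrite (addrC (v 0 0)) (addrC (v 0 1)) !subrK ltNge xy.
apply: contrapT => no; apply: nd => m n im iN; rewrite ltNge; apply/negP => h; apply: no.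
exists (v 0 0 + m), (v 0 1 + n); split; first by rewrite -rad2_lat.
by congr pair; apply/circ_eq; rewrite addrC addKr.
Qed.

(** The hypothesis says that the monodromy preserves [C]; membership in the swept solid torus can
    then be read off any one representative. *)
Lemma solid_torusP (C : set (torus R)) (v : E) :
  (forall v w : E, Gam G false v w -> C (fib v) -> C (fib w)) ->
  forall t, solid_torus (f := f) C (to_Na f (fib v) t) <-> C (fib v).
Proof.
move=> CG t; split=> [[p [t' [Cp e]]]|Cv]; last by exists (fib v), t.
have [w pw [w2 w3]] := fib_surj p t' 0.
pose u := quat (v 0 0) (v 0 1) t 0.
have fu : fib u = fib v by rewrite /fib /u !quatE.
have u3 : w 0 3 = u 0 3 by rewrite w3 /u quatE.
rewrite -fu; apply: CG (w) (u) _ _; last by rewrite -pw.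
by apply/to_Na_eq => //; rewrite w2 -pw fu {1}/u quatE.
Qed.

Lemma solid_odisc (v : E) t : solid_torus (f := f) odisc (to_Na f (fib v) t) <-> ~ Dc G v.
Proof.
rewrite -odiscP; apply: solid_torusP => {}v w vw /odiscP nv; apply/odiscP => dw.
by apply: nv; apply: Gam_Dc dw; exact: Gam_sym vw.
Qed.

Lemma solid_cdisc (v : E) t :
  solid_torus (f := f) cdisc (to_Na f (fib v) t) <-> ~ off G (eps G) v.
Proof.
rewrite -cdiscP; apply: solid_torusP => {}v w vw /cdiscP nv; apply/cdiscP => dw.
apply: nv; apply: Gam_off dw; last exact: Gam_sym vw.
by rewrite !ltW ?eps_gt0 ?eps_lt.
Qed.

Lemma piece1P (v : E) : piece1 (q1 G) (q2 G) (eps G) (cov1 f v) <-> Dc G v.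
Proof.
split=> [h|dv [/solid_odisc h _]]; last exact: h.
by apply: contrapT => /(solid_odisc v (v 0 2)).2 dv; apply: h; split.
Qed.

Lemma piece2P (v : E) : piece2 (q1 G) (q2 G) (eps G) (cov2 f v) <-> Dc G v.
Proof.
split=> [h|dv [_ /solid_odisc h]]; last exact: h.
by apply: contrapT => /(solid_odisc v (v 0 3)).2 dv; apply: h; split.
Qed.

End Covering.

(** * The glued space *)

Section GluedSpace.
Variables (R : realType) (G : setup R).
Local Notation E := 'rV[R]_4.
Local Notation f := (prof G).
Local Notation rad2 := (radius2 (q1 G) (q2 G)).
Local Notation inv := (invert (q1 G) (q2 G) (eps G) (w1 G) (w2 G)).
Local Notation collarG := (collar (al G) (be G) (q1 G) (q2 G) (eps G) (w1 G) (w2 G)).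
Local Notation M := (glued f (q1 G) (q2 G) (eps G) (w1 G) (w2 G)).
Local Notation stepG := (@glue_step R f (q1 G) (q2 G) (eps G) (w1 G) (w2 G)).
Local Notation pieceG := (piece f (q1 G) (q2 G) (eps G)).
Local Notation piece1G := (@piece1 R f (q1 G) (q2 G) (eps G)).
Local Notation piece2G := (@piece2 R f (q1 G) (q2 G) (eps G)).

Lemma Gam_inv b b' (v w : E) : collarG v -> collarG w -> Gam G b v w ->
  Gam G b' (inv v) (inv w).
Proof.
move=> [_ [nv niv]] [_ [nw niw]] vw; have [e0 e1] := nearD_Gam nv nw vw.
have [f0 f1] := inv_xy G e0 e1; have [_ h2 h3 _] := vw.
split; rewrite ?inv2 ?inv3// ?f1 ?f0 ?subrr ?rpred0//.
by rewrite sub0r (nearD_f niv) mulr0 oppr0 rpred0.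
Qed.

Lemma collarP (v : E) : eps G ^+ 2 <= rad2 v <= eps1 G ^+ 2 -> collarG v.
Proof.
have e0 : 0 < eps G ^+ 2 by rewrite exprn_gt0// eps_gt0.
move=> /andP[v1 v2]; split; first by rewrite gt_eqF// (lt_le_trans e0).
split; first exact: nearD_rad2.
apply: nearD_rad2; apply: le_trans (ltW (eps_le_eps1 G)).
by apply: (@rad2_inv_le _ _ _ _ (eps G ^+ 2)) => //; rewrite expr2.
Qed.

Lemma circle_collar (v : E) : rad2 v = eps G ^+ 2 -> collarG v.
Proof. by move=> v1; apply: collarP; rewrite v1 lexx/=; exact/ltW/eps_le_eps1. Qed.

(** The gluing rule on points of the pieces. On the circle [inv] agrees with the reflection, and
    with [inv] the facts about the collar apply. *)
Definition link (a : Na f * circle R) (b : circle R * Na f) : Prop :=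
  exists v, [/\ rad2 v = eps G ^+ 2, a = cov1 f v & b = cov2 f (inv v)].

(** Two lifts of [a] on the circle have the same x and y and differ by integers in the base
    coordinates only; the inversion commutes with such shifts. *)
Lemma link_fun a b b' : link a b -> link a b' -> b = b'.
Proof.
move=> [v [v1 -> ->]] [w [w1 /cov1_eq vw ->]].
by apply/cov2_eq; apply: Gam_inv vw; exact: circle_collar.
Qed.

Lemma rad2_inv_circle (v : E) : rad2 v = eps G ^+ 2 -> rad2 (inv v) = eps G ^+ 2.
Proof.
move=> v1; rewrite rad2_inv v1 divff ?expr1n ?mul1r//.
by rewrite expf_neq0// gt_eqF// eps_gt0.
Qed.

Lemma link_inj a a' b : link a b -> link a' b -> a = a'.
Proof.
move=> [v [v1 -> ->]] [w [w1 -> /cov2_eq vw]].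
have [v0 _] := circle_collar v1; have [w0 _] := circle_collar w1.
apply/cov1_eq; rewrite -(invK v0) -(invK w0).
by apply: Gam_inv vw; apply: circle_collar; exact: rad2_inv_circle.
Qed.

(** Erases the dependent type and the membership proofs, so that the generated equivalence can be
    compared with an explicit relation on a plain sum. *)
Definition key (x : {b : bool & pieceG b}) : (Na f * circle R) + (circle R * Na f) :=
  match x with existT b z =>
    (if b return pieceG b -> _ then fun z : piece2G => inr (val z)
     else fun z : piece1G => inl (val z)) z
  end.

Definition key_rel (k l : (Na f * circle R) + (circle R * Na f)) : Prop :=
  match k, l with
  | inl a, inl a' => a = a'
  | inr b, inr b' => b = b'
  | inl a, inr b | inr b, inl a => link a b
  end.

(** As [link] is the graph of an injective partial function, symmetry and transitivity add nothing
    beyond equality inside each piece. *)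
Lemma glue_key x y : cls stepG x = cls stepG y -> key_rel (key x) (key y).
Proof.
move=> /eqP; rewrite /cls => /eqP/eqmodP/asboolP; elim=> {x y} /=.
- move=> _ _ [v [z1 [z2 [v1 [e1 e2] -> ->]]]] /=; exists v; split=> //.
  by rewrite e2 inv_circle.
- by move=> x; case: (key x).
- by move=> x y _; case: (key x); case: (key y) => //=.
- move=> x y z _ + _; case: (key x) => a; case: (key y) => b; case: (key z) => c //=.
  + by move=> ->.
  + by move=> ->.
  + by move=> ab cb; exact: link_inj ab cb.
  + by move=> ab <-.
  + by move=> ba <-.
  + by move=> ba bc; exact: link_fun ba bc.
  + by move=> ->.
  + by move=> ->.
Qed.

Definition pt1 (z : piece1G) : M := cls stepG (existT pieceG false z).
Definition pt2 (z : piece2G) : M := cls stepG (existT pieceG true z).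

Lemma Dc_nonempty : exists v, Dc G v.
Proof.
(* Half a period above the centre: each translate has vertical distance at least 1/2 > [eps] from
   it. *)
exists (quat (q1 G) (q2 G + 2^-1) 0 0) => m n im /intrP[k ->].
rewrite rad2_lat !quatE.
have e0 := eps_gt0 G; have e1 : eps G < 2^-1 := lt_trans (eps_lt G) (eps1_half G).
have -> : q2 G + 2^-1 + k%:~R - q2 G = 2^-1 + k%:~R by lra.
apply: (@le_trans _ _ ((2^-1 + k%:~R) ^+ 2)); last by rewrite lerDr sqr_ge0.
have [k0|k0] := lerP 0 k.
  have : (0 : R) <= k%:~R by rewrite ler0z.
  by move=> *; nra.
have : (k%:~R : R) <= - 1 by rewrite -[- 1]/((- 1)%:~R) ler_int -ltzD1 addNr.
by move=> *; nra.
Qed.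

Definition base_point : E := proj1_sig (cid Dc_nonempty).

Lemma Dc_base_point : Dc G base_point. Proof. exact: (proj2_sig (cid Dc_nonempty)). Qed.

(** [base] makes [Q] total: outside of [Dc] its values are junk. *)
Definition base (v : E) : E := if pselect (Dc G v) then v else base_point.

Lemma Dc_base v : Dc G (base v).
Proof. by rewrite /base; case: pselect => //= _; exact: Dc_base_point. Qed.

Definition Q (b : bool) (v : E) : M :=
  if b then pt2 (exist _ (cov2 f (base v)) (mem_set ((piece2P G (base v)).2 (Dc_base v))))
  else pt1 (exist _ (cov1 f (base v)) (mem_set ((piece1P G (base v)).2 (Dc_base v)))).

Lemma base_Dc v : Dc G v -> base v = v.
Proof. by rewrite /base; case: pselect. Qed.

Lemma Q1P v : Dc G v -> is_point1 (Q false v) (cov1 f v).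
Proof. by move=> dv; eexists; last reflexivity; rewrite /= base_Dc. Qed.

Lemma Q2P v : Dc G v -> is_point2 (Q true v) (cov2 f v).
Proof. by move=> dv; eexists; last reflexivity; rewrite /= base_Dc. Qed.

Lemma is_point1_eq v (m : M) : Dc G v -> is_point1 m (cov1 f v) -> m = Q false v.
Proof.
move=> dv [z zE ->]; congr pt1; apply: val_inj; rewrite zE/=.
by rewrite base_Dc.
Qed.

Lemma is_point2_eq v (m : M) : Dc G v -> is_point2 m (cov2 f v) -> m = Q true v.
Proof.
move=> dv [z zE ->]; congr pt2; apply: val_inj; rewrite zE/=.
by rewrite base_Dc.
Qed.

Lemma Q_eq b (v w : E) : Dc G v -> Dc G w -> Q b v = Q b w <-> Gam G b v w.
Proof.
move=> dv dw; case: b; split.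
- by move=> /glue_key; rewrite /= !base_Dc// => /cov2_eq.
- move=> /cov2_eq vw; apply: is_point2_eq => //; rewrite -vw; exact: Q2P.
- by move=> /glue_key; rewrite /= !base_Dc// => /cov1_eq.
- move=> /cov1_eq vw; apply: is_point1_eq => //; rewrite -vw; exact: Q1P.
Qed.

Lemma circle_Dc (v : E) : rad2 v = eps G ^+ 2 -> Dc G v.
Proof.
move=> v1; have [_ [nv _]] := circle_collar v1.
by apply/nearD_Dc => //; rewrite v1.
Qed.

Lemma Q_link (v w : E) : Dc G v -> Dc G w -> Q false v = Q true w ->
  exists u, [/\ rad2 u = eps G ^+ 2, Gam G false v u & Gam G true w (inv u)].
Proof.
move=> dv dw /glue_key; rewrite /= !base_Dc// => -[u [u1 /cov1_eq vu /cov2_eq wu]].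
by exists u.
Qed.

Lemma Q_circle (u : E) : rad2 u = eps G ^+ 2 -> Q false u = Q true (inv u).
Proof.
move=> u1; apply/eqmodP/asboolP/Relation_Operators.rst_step.
exists u; do 2 eexists; split; [exact: u1| |reflexivity|reflexivity].
have du := circle_Dc u1; have dv := circle_Dc (rad2_inv_circle u1).
by rewrite /= (base_Dc du) (base_Dc dv) inv_circle.
Qed.

Lemma pt1_Q (z : piece1G) v : val z = cov1 f v -> Dc G v /\ pt1 z = Q false v.
Proof.
move=> zv; have dv : Dc G v by apply/piece1P; rewrite -zv; exact/set_mem/valP.
by split=> //; apply: is_point1_eq dv _; exists z.
Qed.

Lemma pt2_Q (z : piece2G) v : val z = cov2 f v -> Dc G v /\ pt2 z = Q true v.
Proof.
move=> zv; have dv : Dc G v by apply/piece2P; rewrite -zv; exact/set_mem/valP.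
by split=> //; apply: is_point2_eq dv _; exists z.
Qed.

Lemma Q_surj (m : M) : exists b v, Dc G v /\ m = Q b v.
Proof.
have [[b z] <-] : exists x, cls stepG x = m by exists (repr m); rewrite /cls reprK.
case: b z => z.
  by have [v /pt2_Q[dv e]] := cov2_surj (val z); exists true, v.
by have [v /pt1_Q[dv e]] := cov1_surj (val z); exists false, v.
Qed.

(** Continuity along [Dc] only, because off [Dc] the values of [Q] are junk. *)
Lemma Q_continuous b (v : E) (O : set M) : Dc G v -> open O -> O (Q b v) ->
  \forall w \near v, Dc G w -> O (Q b w).
Proof.
move=> dv oO Ov.
have oOb : open (existT pieceG b @^-1` (cls stepG @^-1` O)).
  by have /sigT_openP := (oO : open (cls stepG @^-1` O)); exact.
case: b Ov oOb => Ov [B oB BE].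
  have : B (cov2 f v).
    have [z zv zE] := Q2P dv; rewrite zE in Ov.
    have : (existT pieceG true @^-1` (cls stepG @^-1` O)) z by [].
    by rewrite -BE; change (B (val z) -> B (cov2 f v)); rewrite zv.
  move=> Bv; have : \forall w \near v, B (cov2 f w).
    by apply: (@cov2_continuous R G v); exact: open_nbhs_nbhs.
  apply: filterS => w Bw dw; have [z zw ->] := Q2P dw.
  suff : (existT pieceG true @^-1` (cls stepG @^-1` O)) z by [].
  by rewrite -BE; change (B (val z)); rewrite zw; exact: Bw.
have : B (cov1 f v).
  have [z zv zE] := Q1P dv; rewrite zE in Ov.
  have : (existT pieceG false @^-1` (cls stepG @^-1` O)) z by [].
  by rewrite -BE; change (B (val z) -> B (cov1 f v)); rewrite zv.
move=> Bv; have : \forall w \near v, B (cov1 f w).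
  by apply: (@cov1_continuous R G v); exact: open_nbhs_nbhs.
apply: filterS => w Bw dw; have [z zw ->] := Q1P dw.
suff : (existT pieceG false @^-1` (cls stepG @^-1` O)) z by [].
by rewrite -BE; change (B (val z)); rewrite zw; exact: Bw.
Qed.

(** The traces of [O] on the pieces are traces of images of open sets of R^4 under the open covering
    maps. Only points [v] of [Dc] are tested, so [W b] may reach into the removed discs. *)
Lemma open_glued (W : bool -> set E) (O : set M) : (forall b, open (W b)) ->
  (forall b v, Dc G v -> O (Q b v) <-> exists2 w, W b w & Gam G b w v) ->
  open O.
Proof.
move=> oW OW; change (open (cls stepG @^-1` O)); apply/sigT_openP => -[].
  exists (cov2 f @` W true).
    rewrite openE => _ [v Wv <-]; apply: cov2_nbhs.
    by apply: open_nbhs_nbhs; split=> //; exact: oW.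
  apply/seteqP; split=> z.
    move=> [w Ww wz]; have [dw e] := pt2_Q (esym wz); change (O (pt2 z)).
    by rewrite e; apply/OW => //; exists w => //; exact: Gam_refl.
  have [v zv] := cov2_surj (val z); have [dv e] := pt2_Q zv.
  move=> Oz; have [w Ww /cov2_eq wv] : exists2 w, W true w & Gam G true w v.
    by apply/OW => //; rewrite -e.
  by exists w => //; rewrite wv -zv.
  exists (cov1 f @` W false).
    rewrite openE => _ [v Wv <-]; apply: cov1_nbhs.
    by apply: open_nbhs_nbhs; split=> //; exact: oW.
  apply/seteqP; split=> z.
    move=> [w Ww wz]; have [dw e] := pt1_Q (esym wz); change (O (pt1 z)).
    by rewrite e; apply/OW => //; exists w => //; exact: Gam_refl.
  have [v zv] := cov1_surj (val z); have [dv e] := pt1_Q zv.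
  move=> Oz; have [w Ww /cov1_eq wv] : exists2 w, W false w & Gam G false w v.
    by apply/OW => //; rewrite -e.
  by exists w => //; rewrite wv -zv.
Qed.

Lemma glued_compact : compact [set: M].
Proof.
pose box : set E := [set v | forall i, `[0, 1]%classic (v ord0 i)].
have cbox : compact box.
  have := @rV_compact R 4 (fun=> `[0, 1]%classic) (fun=> @segment_compact R 0 1).
  exact.
have cK : compact (box `&` Dc G) by apply: compact_closedI => //; exact: Dc_closed.
have cQ b : compact (Q b @` (box `&` Dc G)).
  apply: continuous_compact => //.
  apply/subspace_continuousP => v [_ dv] A; rewrite nbhsE => -[B [oO Ov] OA].
  have H := Q_continuous dv oO Ov; rewrite /nbhs/= /within/=.
  by apply: filterS H => w Qw [_ /Qw]; exact: OA.
rewrite (_ : [set: M] = Q false @` (box `&` Dc G) `|` Q true @` (box `&` Dc G)).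
  exact: compactU.
apply/seteqP; split=> // m _; have [b [v [dv ->]]] := Q_surj m.
have [w vw wbox] := Gam_box G b v.
have dw := Gam_Dc vw dv; have -> : Q b v = Q b w by apply/Q_eq.
have kw : (box `&` Dc G) w by split=> // i; rewrite /= in_itv/=; exact: wbox.
by case: b vw {dv}; [right|left]; exists w.
Qed.

End GluedSpace.

Arguments Q {R} G b v : simpl never.

(** * Three sheets over the glued space and their coordinate changes *)

Section Sheets.
Variables (R : realType) (G : setup R).
Local Notation E := 'rV[R]_4.
Local Notation f := (prof G).
Local Notation rad2 := (radius2 (q1 G) (q2 G)).
Local Notation inv := (invert (q1 G) (q2 G) (eps G) (w1 G) (w2 G)).
Local Notation collarG := (collar (al G) (be G) (q1 G) (q2 G) (eps G) (w1 G) (w2 G)).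
Local Notation M := (glued f (q1 G) (q2 G) (eps G) (w1 G) (w2 G)).
Local Notation Q := (Q G).

Definition dom (i : option bool) : set E :=
  if i is Some _ then off G (eps G) else collarG.

(** Inside the circle a collar coordinate is the inversion of a coordinate on the second piece; on
    the circle the two formulas agree by [Q_circle]. *)
Definition sheet (i : option bool) (v : E) : M :=
  if i is Some b then Q b v
  else if eps G ^+ 2 <= rad2 v then Q false v else Q true (inv v).

Lemma eps_range : 0 <= eps G <= eps1 G.
Proof. by rewrite !ltW ?eps_gt0 ?eps_lt. Qed.

Lemma dom_open i : open (dom i).
Proof.
case: i => [b|] /=; last exact: collar_open.
apply: off_open; rewrite ltW ?eps_gt0//=.
exact: lt_trans (eps_lt G) (eps1_half G).
Qed.

Lemma collar_Dc v : collarG v -> eps G ^+ 2 <= rad2 v -> Dc G v.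
Proof. by move=> [_ [nv _]] ev; apply/nearD_Dc. Qed.

Lemma collar_offE v : collarG v -> off G (eps G) v <-> eps G ^+ 2 < rad2 v.
Proof. by move=> [_ [nv _]]; have /andP[e0 e1] := eps_range; exact: nearD_off. Qed.

Lemma collar_neq0 v : collarG v -> rad2 v != 0. Proof. by case. Qed.

Lemma collar_Dc_inv v : collarG v -> rad2 v <= eps G ^+ 2 -> Dc G (inv v).
Proof.
move=> cv ev; apply: collar_Dc; first exact: collar_inv.
apply: (@rad2_inv_ge _ _ _ _ (eps G ^+ 2)) => //; last exact: collar_neq0.
by rewrite exprn_gt0// eps_gt0.
Qed.

Lemma sheet_outer v : eps G ^+ 2 <= rad2 v -> sheet None v = Q false v.
Proof. by rewrite /sheet => ->. Qed.

Lemma sheet_inner v : rad2 v <= eps G ^+ 2 -> sheet None v = Q true (inv v).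
Proof.
move=> ev; rewrite /sheet; case: ifP => // ev'.
by apply: Q_circle; apply/eqP; rewrite eq_le ev ev'.
Qed.

Lemma off_circle u : rad2 u = eps G ^+ 2 -> ~ off G (eps G) u.
Proof. by move=> u1 /(collar_offE (circle_collar u1)); rewrite u1 ltxx. Qed.

Lemma Q_off_ne v w : off G (eps G) v -> off G (eps G) w -> Q false v <> Q true w.
Proof.
move=> dv dw /(Q_link (off_Dc dv) (off_Dc dw))[u [u1 vu _]].
exact: off_circle u1 (Gam_off eps_range vu dv).
Qed.

Lemma sheet_eq_outer v w : off G (eps G) v -> collarG w ->
  Q false v = sheet None w <-> Gam G false v w.
Proof.
move=> dv cw; split.
  have [ew|/ltW ew] := leP (eps G ^+ 2) (rad2 w).
    by rewrite sheet_outer// => /Q_eq; apply; [exact: off_Dc|exact: collar_Dc].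
  rewrite sheet_inner// => /Q_link[||u [u1 vu _]].
  - exact: off_Dc.
  - exact: collar_Dc_inv.
  - by have := off_circle u1 (Gam_off eps_range vu dv).
move=> vw; have dw := Gam_off eps_range vw dv.
have ew := (collar_offE cw).1 dw.
by rewrite sheet_outer ?ltW//; apply/Q_eq => //; exact: off_Dc.
Qed.

Lemma sheet_eq_inner v w : off G (eps G) v -> collarG w ->
  Q true v = sheet None w <-> Gam G true v (inv w).
Proof.
move=> dv cw; split.
  have [ew|/ltW ew] := leP (eps G ^+ 2) (rad2 w); last first.
    by rewrite sheet_inner// => /Q_eq; apply; [exact: off_Dc|exact: collar_Dc_inv].
  rewrite sheet_outer// => /esym /Q_link[||u [u1 _ vu]].
  - exact: collar_Dc.
  - exact: off_Dc.
  - by have := off_circle (rad2_inv_circle u1) (Gam_off eps_range vu dv).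
move=> vw; have dw := Gam_off eps_range vw dv.
have ew := (collar_offE (collar_inv cw)).1 dw.
have ew' : rad2 w <= eps G ^+ 2.
  by rewrite leNgt; apply/negP => /rad2_inv_lt; rewrite ltNge ltW.
by rewrite sheet_inner//; apply/Q_eq => //; exact: off_Dc.
Qed.

(** In the collar the two deck groups induce the same relation, since the twist is trivial near the
    disc; [Gam_inv] passes between them, so [Gam G false] also serves the inner half. *)
Lemma sheet_eq_collar v w : collarG v -> collarG w ->
  sheet None v = sheet None w <-> Gam G false v w.
Proof.
move=> cv cw; split; last first.
  move=> vw; have [e0 e1] := nearD_Gam cv.2.1 cw.2.1 vw.
  have [ev|/ltW ev] := leP (eps G ^+ 2) (rad2 v).
    have ew : eps G ^+ 2 <= rad2 w by rewrite (rad2_xy G e0 e1).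
    by rewrite !sheet_outer//; apply/Q_eq => //; exact: collar_Dc.
  have ew : rad2 w <= eps G ^+ 2 by rewrite (rad2_xy G e0 e1).
  rewrite !sheet_inner//; apply/Q_eq; try exact: collar_Dc_inv.
  exact: Gam_inv vw.
wlog : v w cv cw / rad2 w <= rad2 v.
  move=> H; have [vw|vw] := leP (rad2 w) (rad2 v); first exact: H.
  by move=> /esym /(H w v cw cv (ltW vw)) /Gam_sym.
move=> wv; have [ev|ev] := leP (eps G ^+ 2) (rad2 v); last first.
  have ew := le_lt_trans wv ev.
  rewrite !sheet_inner ?ltW// => /Q_eq vw.
  rewrite -(invK (collar_neq0 cv)) -(invK (collar_neq0 cw)).
  apply: (@Gam_inv _ _ true); try exact: collar_inv.
  by apply: vw; apply: collar_Dc_inv => //; exact: ltW.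
have [ew|ew] := leP (eps G ^+ 2) (rad2 w).
  by rewrite !sheet_outer// => /Q_eq; apply; exact: collar_Dc.
(* A point strictly inside cannot meet one outside: an identification puts [inv w] on the circle,
   against [rad2_inv_gt]. *)
rewrite sheet_outer// sheet_inner ?ltW// => /Q_link[||u [u1 _ wu]].
- exact: collar_Dc.
- by apply: collar_Dc_inv => //; exact: ltW.
have cu := circle_collar u1.
have [e0 e1] := nearD_Gam (collar_inv cw).2.1 (collar_inv cu).2.1 wu.
have := rad2_inv_gt (collar_neq0 cw) ew.
by rewrite -(rad2_xy G e0 e1) rad2_inv_circle// ltxx.
Qed.

(** The coordinate changes between the sheets. *)
Inductive adm : option bool -> option bool -> (E -> E) -> Prop :=
  | AdmDeck b a : intv a -> adm (Some b) (Some b) (deck G b a)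
  | AdmOuterIn a : intv a -> adm (Some false) None (deck G false a)
  | AdmOuterOut a : intv a -> adm None (Some false) (deck G false a)
  | AdmInnerIn a : intv a -> adm (Some true) None (inv \o deck G true a)
  | AdmInnerOut a : intv a -> adm None (Some true) (deck G true a \o inv)
  | AdmCollar a : intv a -> a 0 0 = 0 -> a 0 1 = 0 -> adm None None (deck G false a).

Lemma sheet_adm i j v w : dom i v -> dom j w -> sheet i v = sheet j w ->
  exists2 g, adm i j g & g v = w.
Proof.
case: i j => [b|] [c|] /= dv dw.
- have [->|bc] := eqVneq c b.
    move=> /(Q_eq b (off_Dc dv) (off_Dc dw))/Gam_deckP[a ia ->].
    by exists (deck G b a) => //; exact: AdmDeck.
  move=> e; exfalso; case: b c bc e => -[] //= _ e.
    exact: Q_off_ne dw dv (esym e).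
  exact: Q_off_ne dv dw e.
- case: b => [|].
    move=> /(sheet_eq_inner dv dw)/Gam_deckP[a ia wa].
    exists (inv \o deck G true a); first exact: AdmInnerIn.
    by rewrite /= -wa invK//; exact: collar_neq0.
  move=> /(sheet_eq_outer dv dw)/Gam_deckP[a ia ->].
  by exists (deck G false a) => //; exact: AdmOuterIn.
- case: c => [|] /esym.
    move=> /(sheet_eq_inner dw dv)/Gam_sym/Gam_deckP[a ia wa].
    by exists (deck G true a \o inv); first exact: AdmInnerOut.
  move=> /(sheet_eq_outer dw dv)/Gam_sym/Gam_deckP[a ia ->].
  by exists (deck G false a) => //; exact: AdmOuterOut.
(* Both points are near the disc, so the deck transformation between them fixes x and y; this gives
   the extra conditions of [AdmCollar]. *)
- move=> /(sheet_eq_collar dv dw) vw; have [e0 e1] := nearD_Gam dv.2.1 dw.2.1 vw.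
  have [a ia wa] := Gam_deckP vw; exists (deck G false a) => //.
  move: e0 e1; rewrite wa /deck !quatE (nearD_f dv.2.1) mulr0 subr0 => e0 e1.
  by apply: AdmCollar => //; lra.
Qed.

Lemma adm_sheet i j g v : adm i j g -> dom i v -> dom j (g v) ->
  sheet j (g v) = sheet i v.
Proof.
case=> {i j g} [b a|a|a|a|a|a] ia /=.
- by move=> dv dw; apply/Q_eq; [exact: off_Dc..|exact/Gam_sym/Gam_deck].
- by move=> dv dw; apply/esym/sheet_eq_outer => //; exact: Gam_deck.
- by move=> dv dw; apply/sheet_eq_outer => //; exact/Gam_sym/Gam_deck.
- move=> dv dw; apply/esym/sheet_eq_inner => //; rewrite invK; first exact: Gam_deck.
  (* With [0^-1 = 0] the formula of the inversion fixes the centre, so a point whose inversion lies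
     in the collar is not the centre. *)
  apply: contra_neq (collar_neq0 dw) => r0.
  by rewrite rad2_inv r0 mulr0.
- by move=> dv dw; apply/sheet_eq_inner => //; exact/Gam_sym/Gam_deck.
- by move=> _ _ dv dw; apply/sheet_eq_collar => //; exact/Gam_sym/Gam_deck.
Qed.

Lemma adm_smooth i j g v : adm i j g -> dom i v -> dom j (g v) ->
  exists O, [/\ open O, O v & smooth O g].
Proof.
have dk b a : exists O, [/\ open O, O v & smooth O (deck G b a)].
  by exists setT; split=> //; [exact: openT|exact: deck_smooth].
case=> {i j g} [b a|a|a|a|a|a] ia //=.
- move=> _ cw; exists [set x | rad2 (deck G true a x) != 0]; split.
  + exact/rad2_open/deck_continuous.
  + by apply: contra_neq (collar_neq0 cw) => r0; rewrite rad2_inv r0 mulr0.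
  + exact: inv_deck_smooth.
- move=> cv _; exists [set x | rad2 x != 0]; split.
  + by apply: (rad2_open (g := idfun)) => x.
  + exact: collar_neq0.
  + exact: deck_inv_smooth.
Qed.

Lemma adm_near i j g v : adm i j g -> dom i v -> dom j (g v) ->
  \forall w \near v, [/\ dom i w, dom j (g w) & sheet j (g w) = sheet i w].
Proof.
move=> ag dv dw; have [B [oB Bv Cg]] := adm_smooth ag dv dw.
have cg : {for v, continuous g} := differentiable_continuous (smooth_differentiable Cg Bv).
have n1 : \forall w \near v, dom i w by apply: open_nbhs_nbhs; split=> //; exact: dom_open.
have n2 : \forall w \near v, dom j (g w).
  by apply: cg; apply: open_nbhs_nbhs; split=> //; exact: dom_open.
near=> w; have d1 : dom i w by near: w.
have d2 : dom j (g w) by near: w.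
by split=> //; exact: adm_sheet.
Unshelve. all: by end_near. Qed.

(** For the collar this is the pasting of two closed halves: each formula is continuous along its
    own half, and on the circle both are used. *)
Lemma sheet_continuous i v : dom i v -> {for v, continuous (sheet i)}.
Proof.
move=> dv A; rewrite nbhsE => -[B [oB Bv] BA].
suff : \forall w \near v, B (sheet i w) by apply: filterS => w; exact: BA.
have n1 : \forall w \near v, dom i w by apply: open_nbhs_nbhs; split=> //; exact: dom_open.
case: i dv Bv n1 => [b|] /= dv Bv n1.
  have H := Q_continuous (off_Dc dv) oB Bv.
  near=> w; have dw : dom (Some b) w by near: w.
  by apply: (near H w) => //; exact: off_Dc.
have out : eps G ^+ 2 <= rad2 v -> \forall w \near v, eps G ^+ 2 <= rad2 w -> B (sheet None w).
  move=> ev; rewrite -/(sheet None v) sheet_outer// in Bv.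
  have H := Q_continuous (collar_Dc dv ev) oB Bv.
  near=> w => ew; rewrite sheet_outer//; apply: (near H w) => //.
  by apply: collar_Dc => //; near: w.
have inn : rad2 v <= eps G ^+ 2 -> \forall w \near v, rad2 w <= eps G ^+ 2 -> B (sheet None w).
  move=> ev; rewrite -/(sheet None v) sheet_inner// in Bv.
  have H := Q_continuous (collar_Dc_inv dv ev) oB Bv.
  have H' : \forall w \near v, Dc G (inv w) -> B (Q true (inv w)).
    exact: (inv_continuous (collar_neq0 dv) H).
  near=> w => ew; rewrite sheet_inner//; apply: (near H' w) => //.
  by apply: collar_Dc_inv => //; near: w.
have cr := @rad2_continuous R G v.
have [ev|ev|ev] := ltgtP (rad2 v) (eps G ^+ 2).
- have n2 : \forall w \near v, rad2 w < eps G ^+ 2 by exact: cvgr_lt cr _ ev.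
  have h := inn (ltW ev); near=> w.
  have /ltW : rad2 w < eps G ^+ 2 by near: w.
  by near: w.
- have n2 : \forall w \near v, eps G ^+ 2 < rad2 w by exact: cvgr_gt cr _ ev.
  have h := out (ltW ev); near=> w.
  have /ltW : eps G ^+ 2 < rad2 w by near: w.
  by near: w.
- have h1 := out ltac:(by rewrite ev); have h2 := inn ltac:(by rewrite ev).
  near=> w; have /orP[ew|ew] := le_total (eps G ^+ 2) (rad2 w).
    by move: ew; near: w; exact: h1.
  by move: ew; near: w; exact: h2.
Unshelve. all: by end_near. Qed.

Lemma sheet_open i (W : set E) : open W -> W `<=` dom i -> open (sheet i @` W).
Proof.
case: i => [c|] oW Wd.
  apply: (@open_glued _ _ (fun b => if b == c then W else set0)).
    by move=> b; case: eqP => // _; exact: open0.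
  move=> b v dv; case: eqP => [->|bc]; split.
  - move=> [w Ww /= e]; exists w => //.
    by apply/(Q_eq c (off_Dc (Wd w Ww)) dv).
  - by move=> [w Ww wv]; exists w => //=; apply/(Q_eq c (off_Dc (Wd w Ww)) dv).
  - move=> [w /Wd dw e]; exfalso; clear W oW Wd; case: b c bc dw e => -[] //= _ dw e.
    + have [u [u1 wu _]] := Q_link (off_Dc dw) dv e.
      exact: off_circle u1 (Gam_off eps_range wu dw).
    + have [u [u1 _ wu]] := Q_link dv (off_Dc dw) (esym e).
      exact: off_circle (rad2_inv_circle u1) (Gam_off eps_range wu dw).
  - by move=> [].
(* The image of the collar sheet is traced by [W] on the first piece and by its inversion on the
   second. *)
pose Wi := [set w | rad2 w != 0] `&` inv @^-1` W.
have oWi : open Wi.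
  rewrite openE => v [v0 Wv].
  have n1 : \forall w \near v, rad2 w != 0.
    by apply: open_nbhs_nbhs; split=> //; apply: (rad2_open (g := idfun)) => x.
  have n2 : \forall w \near v, W (inv w).
    by apply: (inv_continuous v0); exact: open_nbhs_nbhs.
  by near=> w; split; near: w.
apply: (@open_glued _ _ (fun b => if b then Wi else W)); first by case.
move=> [] v dv; split.
- move=> [w Ww e]; have cw := Wd w Ww.
  have inn : rad2 w <= eps G ^+ 2 -> exists2 w', Wi w' & Gam G true w' v.
    move=> ew; exists (inv w); first by split; [exact/rad2_inv_neq0/collar_neq0|rewrite /= invK//; exact: collar_neq0].
    by apply/(Q_eq true (collar_Dc_inv cw ew) dv); rewrite -sheet_inner.
  have [ew|/ltW ew] := leP (rad2 w) (eps G ^+ 2); first exact: inn.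
  rewrite sheet_outer// in e.
  have [u [u1 wu _]] := Q_link (collar_Dc cw ew) dv e.
  have [e0 e1] := nearD_Gam cw.2.1 (circle_collar u1).2.1 wu.
  by apply: inn; rewrite -(rad2_xy G e0 e1) u1.
- move=> [w [w0 Ww] wv]; exists (inv w) => //.
  have cw := Wd _ Ww; have dw : Dc G w := Gam_Dc (Gam_sym wv) dv.
  have cw' := collar_inv cw; rewrite invK// in cw'.
  have ew := (nearD_Dc cw'.2.1).1 dw.
  rewrite sheet_inner; last first.
    by apply: (@rad2_inv_le _ _ _ _ (eps G ^+ 2)); rewrite ?expr2// mulr_gt0// eps_gt0.
  by rewrite invK//; apply/Q_eq.
- move=> [w Ww e]; have cw := Wd w Ww.
  have out : eps G ^+ 2 <= rad2 w -> exists2 w', W w' & Gam G false w' v.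
    move=> ew; exists w => //.
    by apply/(Q_eq false (collar_Dc cw ew) dv); rewrite -sheet_outer.
  have [ew|/ltW ew] := leP (eps G ^+ 2) (rad2 w); first exact: out.
  rewrite sheet_inner// in e.
  have [u [u1 _ wu]] := Q_link dv (collar_Dc_inv cw ew) (esym e).
  have cu := circle_collar u1.
  have [e0 e1] := nearD_Gam (collar_inv cw).2.1 (collar_inv cu).2.1 wu.
  have [f0 f1] := inv_xy G e0 e1.
  rewrite !invK ?collar_neq0// in f0 f1.
  by apply: out; rewrite -(rad2_xy G f0 f1) u1.
- move=> [w Ww wv]; exists w => //.
  have cw := Wd _ Ww; have dw : Dc G w := Gam_Dc (Gam_sym wv) dv.
  have ew := (nearD_Dc cw.2.1).1 dw.
  by rewrite sheet_outer//; apply/Q_eq.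
Unshelve. all: by end_near. Qed.

(** In every case equality is either impossible or [Gam] between continuous functions of the two
    points, so [near_notGam] applies. The opening symmetry leaves six of the nine pairs of
    sheets. *)
Lemma sheet_separated i j v w : dom i v -> dom j w -> sheet i v <> sheet j w ->
  \forall p \near (v, w), dom i p.1 -> dom j p.2 -> sheet i p.1 <> sheet j p.2.
Proof.
wlog : i j v w / match i, j with Some false, Some true => False | None, Some _ => False | _, _ => True end.
  move=> H; case: i j => [[]|] [[]|] dv dw vw; try exact: H.
  - have [[A B] [/= nA nB] AB] := H (Some true) (Some false) w v I dw dv (nesym vw).
    by exists (B, A) => // -[x y] [/= Bx Ay] dx dy; exact/nesym/(AB (y, x)).
  - have [[A B] [/= nA nB] AB] := H (Some true) None w v I dw dv (nesym vw).
    by exists (B, A) => // -[x y] [/= Bx Ay] dx dy; exact/nesym/(AB (y, x)).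
  - have [[A B] [/= nA nB] AB] := H (Some false) None w v I dw dv (nesym vw).
    by exists (B, A) => // -[x y] [/= Bx Ay] dx dy; exact/nesym/(AB (y, x)).
case: i j => [[]|] [[]|] // _ dv dw vw.
- have nG : ~ Gam G true v w by move=> /(Q_eq true (off_Dc dv) (off_Dc dw)).
  apply: filterS (near_notGam nG) => p np d1 d2.
  by move=> /(Q_eq true (off_Dc d1) (off_Dc d2)).
- exists (setT, setT); first by split; exact: filterT.
  by move=> [x y] _ d1 d2; exact/nesym/Q_off_ne.
- have nG : ~ Gam G true v (inv w) by move=> /(sheet_eq_inner dv dw).
  have [[A B] [/= nA nB] AB] := near_notGam nG.
  exists (A, inv @^-1` B); first by split=> //; exact: (inv_continuous (collar_neq0 dw)).
  move=> [x y] [/= Ax By] dx dy /(sheet_eq_inner dx dy).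
  exact: (AB (x, inv y)).
- have nG : ~ Gam G false v w by move=> /(Q_eq false (off_Dc dv) (off_Dc dw)).
  apply: filterS (near_notGam nG) => p np d1 d2.
  by move=> /(Q_eq false (off_Dc d1) (off_Dc d2)).
- have nG : ~ Gam G false v w by move=> /(sheet_eq_outer dv dw).
  apply: filterS (near_notGam nG) => p np d1 d2.
  by move=> /(sheet_eq_outer d1 d2).
- have nG : ~ Gam G false v w by move=> /(sheet_eq_collar dv dw).
  apply: filterS (near_notGam nG) => p np d1 d2.
  by move=> /(sheet_eq_collar d1 d2).
Qed.

End Sheets.

(** * Matrices acting on the directions x, y, z0 *)

Section Matrices.
Variable R : realType.
Implicit Types a b c d e f g h k : R.

(** All Jacobians and frames below fix d/dz1. The third row and column belong to z0, the direction
    that gives room for the contraction. *)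
Definition m3 a b c d e f g h k : 'M[R]_4 :=
  \matrix_(i, j) nth 0 (nth [::] [:: [:: a; b; c; 0]; [:: d; e; f; 0]; [:: g; h; k; 0];
                                    [:: 0; 0; 0; 1]] i) j.

Lemma m3_mul a b c d e f g h k a' b' c' d' e' f' g' h' k' :
  m3 a b c d e f g h k *m m3 a' b' c' d' e' f' g' h' k' =
  m3 (a * a' + b * d' + c * g') (a * b' + b * e' + c * h') (a * c' + b * f' + c * k')
     (d * a' + e * d' + f * g') (d * b' + e * e' + f * h') (d * c' + e * f' + f * k')
     (g * a' + h * d' + k * g') (g * b' + h * e' + k * h') (g * c' + h * f' + k * k').
Proof.
apply/matrixP; do 2 apply: ord4P; rewrite !mxE !big_ord_recl big_ord0 !mxE /=; lra.
Qed.

Lemma m3_1 : m3 1 0 0 0 1 0 0 0 1 = 1%:M.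
Proof. by apply/matrixP; do 2 apply: ord4P; rewrite !mxE. Qed.

Lemma det_m3 a b c d e f g h k :
  \det (m3 a b c d e f g h k) = a * (e * k - f * h) - b * (d * k - f * g) + c * (d * h - e * g).
Proof.
rewrite (expand_det_row _ 3) !big_ord_recl big_ord0 !mxE /= !mul0r !add0r addr0 mul1r.
rewrite /cofactor.
rewrite (expand_det_row _ 0) !big_ord_recl big_ord0 /cofactor.
rewrite !(expand_det_row _ 0) !big_ord_recl !big_ord0 /cofactor !det_mx11 !mxE /=.
rewrite /bump /= !expr0 !expr1 ?exprS ?expr0.
lra.
Qed.

Definition shear s := m3 1 0 0 s 1 0 0 0 1.

Lemma shear_mul s t : shear s *m shear t = shear (s + t).
Proof. rewrite m3_mul; congr (m3 _ _ _ _ _ _ _ _ _); lra. Qed.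

Lemma shear0 : shear 0 = 1%:M. Proof. exact: m3_1. Qed.

Lemma det_shear s : \det (shear s) = 1.
Proof. rewrite det_m3; lra. Qed.

(** Multiplication by [a + i b] on the (x, y)-plane, acting on row vectors. *)
Definition cmul a b := m3 a b 0 (- b) a 0 0 0 1.

Lemma cmul_mul a b c d : cmul a b *m cmul c d = cmul (a * c - b * d) (a * d + b * c).
Proof. rewrite m3_mul; congr (m3 _ _ _ _ _ _ _ _ _); lra. Qed.

Lemma det_cmul a b : \det (cmul a b) = a ^+ 2 + b ^+ 2.
Proof. rewrite det_m3; lra. Qed.

End Matrices.

(** * Jacobians of the coordinate changes *)

Section Jacobians.
Variables (R : realType) (G : setup R).
Local Notation f := (prof G).
Local Notation rad2 := (radius2 (q1 G) (q2 G)).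
Local Notation nearD := (near_disc (al G) (be G) (q1 G)).
Local Notation inv := (invert (q1 G) (q2 G) (eps G) (w1 G) (w2 G)).
Local Notation pd := (@prof_derivable R G).

Lemma jacobian_deck b a v : 'J (deck G b a) v = shear (- tm b a * derive1 f (v 0 1)).
Proof.
rewrite deck_evalr (jacobian_evalr pd); last exact: wf_deckE.
apply/matrixP; do 2 apply: ord4P; rewrite !mxE /deckE /= ?mxE /=; lra.
Qed.

(** The complex derivative - eps^2 w / u^2, with real denominator: - eps^2 w conj(u)^2 / |u|^4. *)
Lemma jacobian_inv v : rad2 v != 0 ->
  let u0 := v 0 0 - q1 G in let u1 := v 0 1 - q2 G in
  let k := - (eps G ^+ 2 / rad2 v ^+ 2) in
  'J inv v = cmul (k * (w1 G * (u0 ^+ 2 - u1 ^+ 2) + 2 * w2 G * u0 * u1))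
                  (k * (w2 G * (u0 ^+ 2 - u1 ^+ 2) - 2 * w1 G * u0 * u1)).
Proof.
move=> v0 u0 u1 k.
rewrite inv_evalr (jacobian_evalr pd); last first.
  by apply: wf_invertE => //; rewrite evalr_Coord.
have rE : (v 0 0 - q1 G) * (v 0 0 - q1 G) + (v 0 1 - q2 G) * (v 0 1 - q2 G) = rad2 v by [].
set r := (rad2 v)^-1.
have r1 : r * (u0 ^+ 2 + u1 ^+ 2) = 1 by rewrite mulVf.
have kE : k = - (eps G ^+ 2 * (r * r)) by rewrite /k [rad2 v ^+ 2]expr2 invfM.
(* The entries agree only modulo [r1]; these are the multiples of it that make the comparison
   linear. *)
have z1 : eps G ^+ 2 * w1 G * r * (r * (u0 ^+ 2 + u1 ^+ 2) - 1) = 0 by rewrite r1 subrr mulr0.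
have z2 : eps G ^+ 2 * w2 G * r * (r * (u0 ^+ 2 + u1 ^+ 2) - 1) = 0 by rewrite r1 subrr mulr0.
rewrite kE; apply/matrixP; do 2 apply: ord4P;
  rewrite !mxE /invertE /sel4 /= ?mxE /= ?rE -/r -/u0 -/u1.
all: lra.
Qed.

Lemma derive1_prof_int y n : isint n -> derive1 f (y + n) = derive1 f y.
Proof.
move=> iN; rewrite /derive1.
suff -> : (fun h : R => h^-1 *: (f (h + (y + n)) - f (y + n) : R^o)) =
          (fun h : R => h^-1 *: (f (h + y) - f y : R^o)) by [].
by apply/funext => h; rewrite addrA !(@profDint _ _ _ _ iN) opprD addrACA subrr addr0.
Qed.

Lemma nearD_derive1 v : nearD v -> derive1 f (v 0 1) = 0.
Proof.
move=> [_ /andP[l u]].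
rewrite derive1E (near_eq_derive (g := cst 0)) ?derive_cst//.
near=> y; apply: prof0; apply: ltW; near: y; [exact: lt_nbhsr|exact: lt_nbhsl].
Unshelve. all: by end_near. Qed.

Lemma det_jacobian_inv v : rad2 v != 0 -> 0 < \det ('J inv v).
Proof.
move=> v0; rewrite (jacobian_inv v0) /= det_cmul.
set u0 := v 0 0 - q1 G; set u1 := v 0 1 - q2 G; set k := - _.
have -> : (k * (w1 G * (u0 ^+ 2 - u1 ^+ 2) + 2 * w2 G * u0 * u1)) ^+ 2 +
    (k * (w2 G * (u0 ^+ 2 - u1 ^+ 2) - 2 * w1 G * u0 * u1)) ^+ 2 =
    (w1 G ^+ 2 + w2 G ^+ 2) * (k * (u0 ^+ 2 + u1 ^+ 2)) ^+ 2 by lra.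
rewrite w_unit mul1r lt0r sqr_ge0 andbT sqrf_eq0 mulf_neq0//.
by rewrite oppr_eq0 mulf_neq0// ?invr_eq0 expf_neq0// gt_eqF// eps_gt0.
Qed.

Lemma adm_det i j g v : adm G i j g -> dom G i v -> dom G j (g v) -> 0 < \det ('J g v).
Proof.
have dd b a w : 0 < \det ('J (deck G b a) w) by rewrite jacobian_deck det_shear ltr01.
case=> {i j g} [b a|a|a|a|a|a] ia //=.
- move=> _ cw; have r0 : rad2 (deck G true a v) != 0.
    by apply: contra_neq (collar_neq0 cw) => r0; rewrite rad2_inv r0 mulr0.
  rewrite jacobian_comp; [|exact: deck_differentiable|exact: inv_differentiable].
  by rewrite det_mulmx mulr_gt0// det_jacobian_inv.
- move=> cv _; have r0 := collar_neq0 cv.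
  rewrite jacobian_comp; [|exact: inv_differentiable|exact: deck_differentiable].
  by rewrite det_mulmx mulr_gt0// det_jacobian_inv.
Qed.

End Jacobians.

(** * The smooth structure and the Hausdorff property *)

Section Atlas.
Variables (R : realType) (G : setup R).
Local Notation E := 'rV[R]_4.
Local Notation f := (prof G).
Local Notation rad2 := (radius2 (q1 G) (q2 G)).
Local Notation inv := (invert (q1 G) (q2 G) (eps G) (w1 G) (w2 G)).
Local Notation M := (glued f (q1 G) (q2 G) (eps G) (w1 G) (w2 G)).
Local Notation A := (glued_atlas f (al G) (be G) (q1 G) (q2 G) (eps G) (w1 G) (w2 G)).

Definition pchart (i : option bool) : chart R M := (dom G i, sheet G i).

(** The covering coordinates prescribed by the atlas determine the point of the glued space, so each
    chart is the restriction of a sheet. Everything about arbitrary charts is reduced to sheets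
    here. *)
Lemma atlas_sheet (c : chart R M) : A c ->
  [/\ open c.1, {in c.1 &, injective c.2} &
      exists2 i, c.1 `<=` dom G i & forall v, c.1 v -> c.2 v = sheet G i v].
Proof.
move=> [oc ic cS]; split=> //; case: cS => cS.
- exists (Some false) => v /cS[h p]; have dv : off G (eps G) v.
  + by apply: contrapT => /(@solid_cdisc R G v (v 0 2)).2.
  + by [].
  + by apply: contrapT => /(@solid_cdisc R G v (v 0 2)).2.
  + exact: is_point1_eq (off_Dc dv) p.
- exists (Some true) => v /cS[h p]; have dv : off G (eps G) v.
  + by apply: contrapT => /(@solid_cdisc R G v (v 0 3)).2.
  + by [].
  + by apply: contrapT => /(@solid_cdisc R G v (v 0 3)).2.
  + exact: is_point2_eq (off_Dc dv) p.
- exists None => v /cS[cv]; first by [].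
  have [ev|/ltW ev] := leP (eps G ^+ 2) (rad2 v) => p.
    by rewrite sheet_outer//; exact: is_point1_eq (collar_Dc cv ev) p.
  by rewrite sheet_inner//; exact: is_point2_eq (collar_Dc_inv cv ev) p.
Qed.

Lemma sheet_atlas i (U : set E) : open U -> U `<=` dom G i ->
  {in U &, injective (sheet G i)} -> A (U, sheet G i).
Proof.
move=> oU Ud inj; split=> //=; case: i Ud {inj} => [[]|] Ud.
- constructor 2 => v /Ud dv; split; last exact/Q2P/off_Dc.
  by move=> /solid_cdisc.
- constructor 1 => v /Ud dv; split; last exact/Q1P/off_Dc.
  by move=> /solid_cdisc.
- constructor 3 => v /Ud cv; split=> //; case: ifP => ev.
    by rewrite sheet_outer//; apply: Q1P; exact: collar_Dc.
  move/negbT: ev; rewrite -ltNge => /ltW ev.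
  by rewrite sheet_inner//; apply: Q2P; exact: collar_Dc_inv.
Qed.

Lemma sheet_locally_injective i v w : dom G i v -> dom G i w ->
  (forall k, `|v 0 k - w 0 k| < 1) -> sheet G i v = sheet G i w -> v = w.
Proof.
case: i => [b|] dv dw vw.
  by move=> /(Q_eq b (off_Dc dv) (off_Dc dw)); exact: Gam_ball.
by move=> /(sheet_eq_collar dv dw); exact: Gam_ball.
Qed.

Lemma chart_at i v : dom G i v ->
  exists U, [/\ open U, U v, U `<=` dom G i & A (U, sheet G i)].
Proof.
(* Half of the scale 1 at which sheets are injective, so that any two points of [N] are within that
   scale. *)
move=> dv; pose N : set E := [set w | forall k : 'I_4, `|v 0 k - w 0 k| < 2^-1].
have nN : nbhs v N by apply: near_coord.
have nD : nbhs v (dom G i) by apply: open_nbhs_nbhs; split=> //; exact: dom_open.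
exists (N `&` dom G i)°.
have sub : (N `&` dom G i)° `<=` N `&` dom G i by exact: interior_subset.
split; [exact: open_interior| |by move=> w /sub[]|].
  by apply: nbhs_singleton; apply: nbhs_interior; exact: filterI.
apply: sheet_atlas; [exact: open_interior|by move=> w /sub[]|].
move=> x y /set_mem/sub[Nx dx] /set_mem/sub[Ny dy].
apply: sheet_locally_injective => // k.
rewrite -(subrKA (v 0 k)) (le_lt_trans (ler_normD _ _))//.
by rewrite (splitr 1) ltrD// ?div1r// distrC.
Qed.

(** Points of the pieces at distance at most [eps1] from the removed discs are
    covered by the collar. *)
Definition dom1 (i : option bool) : set E :=
  if i is Some _ then off G (eps1 G) else dom G None.

Lemma dom1_dom i : dom1 i `<=` dom G i.
Proof. by case: i => [b|] //=; exact: off1_off. Qed.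

Lemma dom1_open i : open (dom1 i).
Proof.
case: i => [b|]; last exact: dom_open.
by apply: off_open; rewrite ltW ?eps1_gt0 ?eps1_half.
Qed.

Lemma sheet_cover (m : M) : exists i v, dom1 i v /\ sheet G i v = m.
Proof.
have [b [v [dv ->]]] := Q_surj m.
have [ov|/existsNP[m1 /existsNP[m2 /not_implyP[im1 /not_implyP[im2 /negP]]]]] := pselect (off G (eps1 G) v).
  by exists (Some b), v.
rewrite -leNgt => lv; pose w := lat m1 m2 v.
have vw : Gam G b v w by exact: Gam_latP.
have dw : Dc G w := Gam_Dc vw dv.
have ew := (nearD_Dc (nearD_rad2 lv)).1 dw.
have cw : dom G None w by apply: collarP; rewrite ew lv.
have -> : Q G b v = Q G b w by apply/Q_eq.
exists None; case: b {vw}; last by exists w; split=> //; exact: sheet_outer.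
(* A point of the second piece close to its disc is reached from the inner half of the collar. *)
exists (inv w); split; first exact: collar_inv.
rewrite sheet_inner ?invK//; first exact: collar_neq0 cw.
by apply: (@rad2_inv_le _ _ _ _ (eps G ^+ 2)); rewrite ?expr2// mulr_gt0// eps_gt0.
Qed.

Lemma atlas_is_chart c : A c -> is_chart c.
Proof.
move=> /atlas_sheet[oc ic [i cd cE]]; split=> //.
  apply: continuous_in_subspaceT => v /set_mem cv.
  apply: (near_eq_continuous _ (sheet_continuous (cd v cv))).
  by near=> w; apply: cE; near: w; exact: open_nbhs_nbhs.
move=> W oW Wc; have -> : c.2 @` W = sheet G i @` W.
  by apply/seteqP; split=> _ [w Ww <-]; exists w => //; [apply/esym|]; exact/cE/Wc.
by apply: sheet_open => // w /Wc; exact: cd.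
Unshelve. all: by end_near. Qed.

Lemma transition_unique (c d : chart R M) v w : {in d.1 &, injective d.2} ->
  d.1 w -> d.2 w = c.2 v -> transition c d v = w.
Proof.
move=> inj dw e; rewrite /transition; case: xgetP => [x _ [dx ex]|/(_ w)].
  by apply: inj; rewrite ?inE// ex e.
by case.
Qed.

(** The equation solved by [g] at [v] persists nearby, and injectivity of [d] leaves [transition] no
    other value. *)
Lemma transition_adm (d : chart R M) i v w : A d -> dom G i v -> d.1 w ->
  d.2 w = sheet G i v ->
  exists j g, [/\ adm G i j g, dom G j w, g v = w &
    \forall x \near v, [/\ dom G i x, d.1 (g x), d.2 (g x) = sheet G i x &
      transition (pchart i) d x = g x]].
Proof.
move=> /atlas_sheet[od inj [j dd dE]] dv dw e.
rewrite (dE w dw) in e; have [g ag gv] := sheet_adm dv (dd w dw) (esym e).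
exists j, g; split=> //; first exact: dd.
have djgv : dom G j (g v) by rewrite gv; exact: dd.
have [B [oB Bv Cg]] := adm_smooth ag dv djgv.
have cg : {for v, continuous g} := differentiable_continuous (smooth_differentiable Cg Bv).
have n1 : \forall x \near v, d.1 (g x).
  by apply: cg; apply: open_nbhs_nbhs; split=> //; rewrite gv.
have n2 := adm_near ag dv djgv.
near=> x; have [dx dgx gx] : [/\ dom G i x, dom G j (g x) & sheet G j (g x) = sheet G i x].
  by near: x.
have d1x : d.1 (g x) by near: x.
have dgE : d.2 (g x) = sheet G i x by rewrite dE.
by split=> //; exact: transition_unique.
Unshelve. all: by end_near. Qed.

Lemma transition_sheet (c d : chart R M) i v : c.2 v = sheet G i v ->
  transition c d v = transition (pchart i) d v.
Proof. by rewrite /transition => ->. Qed.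

(** [transition (pchart i) d] is defined although [pchart i] is not injective,
    because [d] is. *)
Lemma pchart_transition (d : chart R M) i v w : A d -> dom G i v -> d.1 w ->
  d.2 w = sheet G i v ->
  [/\ differentiable (transition (pchart i) d) v,
      0 < \det ('J (transition (pchart i) d) v),
      transition (pchart i) d v = w &
      exists B g, [/\ open B, B v, {in B, transition (pchart i) d =1 g} & smooth B g]].
Proof.
move=> Ad dv dw e; have [j [g [ag djw gv n]]] := transition_adm Ad dv dw e.
have djgv : dom G j (g v) by rewrite gv.
have [B [oB Bv Cg]] := adm_smooth ag dv djgv.
have dg := smooth_differentiable Cg Bv.
have n' : \forall x \near v, transition (pchart i) d x = g x by apply: filterS n => x [].
split.
- exact: (near_eq_is_diff n' dg).1.
- by rewrite (jacobian_near n' dg); exact: adm_det ag dv djgv.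
- by rewrite (nbhs_singleton n').
- exists (B `&` [set x | transition (pchart i) d x = g x]°), g; split.
  + by apply: openI => //; exact: open_interior.
  + by split=> //; exact: n'.
  + by move=> x /set_mem[_ /interior_subset].
  + move=> k; apply: class_C_local => x [Bx _].
    by exists B, g; split=> //; exact: Cg.
Qed.

Lemma transition_smooth c d : A c -> A d ->
  smooth (overlap c d) (transition c d) /\
  forall v, overlap c d v -> 0 < \det ('J (transition c d) v).
Proof.
move=> Ac Ad; have [oc ic [i cd cE]] := atlas_sheet Ac.
have near_pc v : c.1 v -> \forall x \near v, transition c d x = transition (pchart i) d x.
  move=> cv; near=> x; apply: transition_sheet; apply: cE.
  by near: x; exact: open_nbhs_nbhs.
split=> [|v [cv [w dw e]]].
  apply: smooth_local => v [cv [w dw e]]; rewrite (cE v cv) in e.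
  have [_ _ _ [B [g [oB Bv Bg Cg]]]] := pchart_transition Ad (cd v cv) dw e.
  exists (B `&` c.1), g; split=> //.
  + exact: openI.
  + move=> x /set_mem[Bx cx]; rewrite (@transition_sheet c d i); last exact: cE.
    by apply: Bg; exact/mem_set.
  + move=> k; apply: class_C_local => x [Bx _].
    by exists B, g; split=> //; exact: Cg.
rewrite (cE v cv) in e.
have [dt dpos _ _] := pchart_transition Ad (cd v cv) dw e.
by rewrite (jacobian_near (near_pc v cv) dt).
Unshelve. all: by end_near. Qed.

Lemma glued_hausdorff : hausdorff_space M.
Proof.
rewrite open_hausdorff => x y xy.
have [i [v [/dom1_dom dv vx]]] := sheet_cover x.
have [j [w [/dom1_dom dw wy]]] := sheet_cover y.
have ne : sheet G i v <> sheet G j w by rewrite vx wy; exact/eqP.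
have [[V W] [/= nV nW] VW] := sheet_separated dv dw ne.
pose V' := V° `&` dom G i; pose W' := W° `&` dom G j.
have oV : open V' by apply: openI; [exact: open_interior|exact: dom_open].
have oW : open W' by apply: openI; [exact: open_interior|exact: dom_open].
exists (sheet G i @` V', sheet G j @` W').
  by split; apply/mem_set; [exists v|exists w].
split; [apply: sheet_open => // ? []//..|].
apply/eqP; rewrite -subset0 => _ [[a [Va da] <-] [b [Wb db] e]].
by apply: (VW (a, b)); rewrite ?e//; split; exact: nbhs_singleton.
Qed.

Lemma glued_manifold : closed_oriented_manifold A.
Proof.
split; [exact: glued_hausdorff|exact: glued_compact|split].
- exact: atlas_is_chart.
- move=> m; have [i [v [/dom1_dom dv <-]]] := sheet_cover m.
  have [U [oU Uv _ AU]] := chart_at dv.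
  by exists (U, sheet G i) => //; exists v.
- exact: transition_smooth.
Qed.

End Atlas.

(** * A global frame *)

Section MatrixFunctions.
Variables (R : realType) (T : topologicalType).
Implicit Types (g h : T -> R) (x : T).

Lemma addf_continuous g h x : {for x, continuous g} -> {for x, continuous h} ->
  {for x, continuous (fun y => g y + h y)}.
Proof. by move=> cg ch; exact: (@cvgD _ R^o _ _ _ _ _ _ _ cg ch). Qed.

Lemma oppf_continuous g x : {for x, continuous g} -> {for x, continuous (fun y => - g y)}.
Proof. by move=> cg; exact: (@cvgN _ R^o _ _ _ _ _ cg). Qed.

Lemma mulf_continuous g h x : {for x, continuous g} -> {for x, continuous h} ->
  {for x, continuous (fun y => g y * h y)}.
Proof. by move=> cg ch; exact: (cvgM cg ch). Qed.

Lemma sqrf_continuous g x : {for x, continuous g} -> {for x, continuous (fun y => g y ^+ 2)}.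
Proof. by move=> cg; exact: (mulf_continuous cg cg). Qed.

Lemma cstf_continuous (k : R) x : {for x, continuous (fun=> k)}.
Proof. exact: cvg_cst. Qed.

Lemma mulmx_continuous (A B : T -> 'M[R]_4) x : {for x, continuous A} ->
  {for x, continuous B} -> {for x, continuous (fun y => A y *m B y)}.
Proof.
move=> /mx_continuousP cA /mx_continuousP cB; apply/mx_continuousP => i j.
have -> : (fun y => (A y *m B y) i j) = (fun y => A y i 0 * B y 0 j +
    (A y i 1 * B y 1 j + (A y i 2 * B y 2 j + A y i 3 * B y 3 j))).
  apply/funext => y; rewrite mxE !big_ord_recl big_ord0 addr0.
  by congr (_ * _ + (_ * _ + (_ * _ + _ * _))); congr (_ _ _); exact: val_inj.
by do 3 (apply: addf_continuous; first exact: mulf_continuous); exact: mulf_continuous.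
Qed.

Lemma m3_continuous (a b c d e f g h k : T -> R) x :
  {for x, continuous a} -> {for x, continuous b} -> {for x, continuous c} ->
  {for x, continuous d} -> {for x, continuous e} -> {for x, continuous f} ->
  {for x, continuous g} -> {for x, continuous h} -> {for x, continuous k} ->
  {for x, continuous (fun y => m3 (a y) (b y) (c y) (d y) (e y) (f y) (g y) (h y) (k y))}.
Proof.
move=> *; apply/mx_continuousP; do 2 apply: ord4P.
all: apply: near_eq_continuous; first by apply: nearW => y; rewrite mxE /=; reflexivity.
all: first [assumption | exact: cstf_continuous].
Qed.

End MatrixFunctions.

Section FrameModel.
Variables (R : realType) (G : setup R).
Local Notation E := 'rV[R]_4.
Local Notation f := (prof G).
Local Notation rad2 := (radius2 (q1 G) (q2 G)).
Local Notation inv := (invert (q1 G) (q2 G) (eps G) (w1 G) (w2 G)).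

Definition twisted (b : bool) (v : E) : 'M[R]_4 := shear (- tm b v * derive1 f (v 0 1)).

Definition outer_rad : R := eps1 G ^+ 2.
(** The squared radius of the inversion of the circle of radius [eps1]: inside it, the inverted
    point is off the larger disc of the second piece. *)
Definition inner_rad : R := (eps G ^+ 2) ^+ 2 / outer_rad.

(** Piecewise linear in [rad2], as a frame need only be continuous. *)
Definition cutoff (v : E) : R :=
  Num.max 0 (Num.min 1 ((rad2 v - inner_rad) / (outer_rad - inner_rad))).

(** [pa] and [pb] run along the segment from u / eps to 1, which hits 0 when u is real and negative.
    The component [pc] along j, positive strictly between the two ends, avoids this zero. *)
Definition pa (v : E) : R := cutoff v + (1 - cutoff v) * ((v 0 0 - q1 G) / eps G).
Definition pb (v : E) : R := (1 - cutoff v) * ((v 0 1 - q2 G) / eps G).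
Definition pc (v : E) : R := cutoff v * (1 - cutoff v).
(** At the inner end x |-> p x p stretches lengths by |p|^2 = [rad2 v / eps G ^+ 2]; this factor
    restores d/dz0 in the third row. The minimum makes it 1 outside the circle of radius [eps]. *)
Definition mu (v : E) : R := (Num.min 1 (rad2 v / eps G ^+ 2))^-1.

(** For the quaternion [p = a + b i + c j], the rows are the images of 1, i, j
    under [x |-> p x p], the third one multiplied by [mu].  The loop of
    rotations [u |-> (x |-> u x u)] has winding number 2 in the (x, y)-plane, and
    [u] is contracted to 1 in the nonzero quaternions. *)
Definition collar_frame (v : E) : 'M[R]_4 :=
  m3 (pa v ^+ 2 - pb v ^+ 2 - pc v ^+ 2) (2 * pa v * pb v) (2 * pa v * pc v)
     (- (2 * pa v * pb v)) (pa v ^+ 2 - pb v ^+ 2 + pc v ^+ 2) (- (2 * pb v * pc v))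
     (- (2 * pa v * pc v) * mu v) (- (2 * pb v * pc v) * mu v)
     ((pa v ^+ 2 + pb v ^+ 2 - pc v ^+ 2) * mu v).

(** The constant factor in the second piece absorbs the rotation by - w left over from the
    inversion. It acts on the left, Jacobians on the right, so deck invariance is unaffected. *)
Definition model_frame (i : option bool) (v : E) : 'M[R]_4 :=
  match i with
  | Some false => twisted false v
  | Some true => cmul (- w1 G) (- w2 G) *m twisted true v
  | None => collar_frame v
  end.

Lemma outer_gt0 : 0 < outer_rad.
Proof. by rewrite exprn_gt0// eps1_gt0. Qed.

Lemma inner_outer : inner_rad < outer_rad.
Proof.
rewrite /inner_rad ltr_pdivrMr ?outer_gt0// -expr2.
by rewrite ltr_pXn2r ?nnegrE ?sqr_ge0 ?ltW ?outer_gt0// ?eps_le_eps1.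
Qed.

Lemma inner_lt_eps : inner_rad < eps G ^+ 2.
Proof.
rewrite /inner_rad ltr_pdivrMr ?outer_gt0// (expr2 (eps G ^+ 2)).
by rewrite ltr_pM2l ?eps_le_eps1// exprn_gt0// eps_gt0.
Qed.

Lemma cutoff_outer v : outer_rad <= rad2 v -> cutoff v = 1.
Proof.
move=> h; rewrite /cutoff; have io := inner_outer.
rewrite min_l; first by rewrite max_r// ler01.
by rewrite ler_pdivlMr ?subr_gt0// mul1r lerB.
Qed.

Lemma cutoff_inner v : rad2 v <= inner_rad -> cutoff v = 0.
Proof.
move=> h; rewrite /cutoff; have io := inner_outer.
rewrite max_l// ge_min; apply/orP; right.
by rewrite ler_pdivrMr ?subr_gt0// mul0r subr_le0.
Qed.

Lemma eps2_gt0 : 0 < eps G ^+ 2. Proof. by rewrite exprn_gt0// eps_gt0. Qed.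

Lemma collar_frame_outer v : outer_rad < rad2 v -> collar_frame v = 1%:M.
Proof.
move=> h; have c1 := cutoff_outer (ltW h).
have mu1 : mu v = 1.
  rewrite /mu min_l ?invr1// ler_pdivlMr ?eps2_gt0// mul1r.
  exact: ltW (lt_trans (eps_le_eps1 G) h).
rewrite /collar_frame mu1 /pa /pb /pc c1 subrr mul0r mulr0 mul0r addr0 -m3_1.
by congr (m3 _ _ _ _ _ _ _ _ _); lra.
Qed.

Lemma collar_frame_inner v : rad2 v != 0 -> rad2 v < inner_rad ->
  collar_frame v =
  cmul (((v 0 0 - q1 G) ^+ 2 - (v 0 1 - q2 G) ^+ 2) / eps G ^+ 2)
       (2 * (v 0 0 - q1 G) * (v 0 1 - q2 G) / eps G ^+ 2).
Proof.
move=> v0 h; have c0 := cutoff_inner (ltW h).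
have e2 := eps2_gt0; have r0 := rad2_gt0 v0.
have mu1 : mu v * (rad2 v / eps G ^+ 2) = 1.
  rewrite /mu min_r ?mulVf// ?mulf_neq0 ?invr_eq0 ?gt_eqF//.
  by rewrite ler_pdivrMr// mul1r ltW// (lt_trans h)// inner_lt_eps.
rewrite -exprVn /radius2 in mu1 *.
rewrite /collar_frame /pa /pb /pc c0 subr0 !mul0r add0r !mul1r.
by congr (m3 _ _ _ _ _ _ _ _ _); rewrite -1?[RHS]mu1; lra.
Qed.

Lemma det_collar_frame v : rad2 v != 0 -> 0 < \det (collar_frame v).
Proof.
move=> v0; rewrite det_m3.
(* On the span of 1, i, j the map x |-> p x p has determinant |p|^6. *)
have -> : (pa v ^+ 2 - pb v ^+ 2 - pc v ^+ 2) *
   ((pa v ^+ 2 - pb v ^+ 2 + pc v ^+ 2) * ((pa v ^+ 2 + pb v ^+ 2 - pc v ^+ 2) * mu v) -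
    - (2 * pb v * pc v) * (- (2 * pb v * pc v) * mu v)) -
   2 * pa v * pb v *
   (- (2 * pa v * pb v) * ((pa v ^+ 2 + pb v ^+ 2 - pc v ^+ 2) * mu v) -
    - (2 * pb v * pc v) * (- (2 * pa v * pc v) * mu v)) +
   2 * pa v * pc v *
   (- (2 * pa v * pb v) * (- (2 * pb v * pc v) * mu v) -
    (pa v ^+ 2 - pb v ^+ 2 + pc v ^+ 2) * (- (2 * pa v * pc v) * mu v)) =
   mu v * (pa v ^+ 2 + pb v ^+ 2 + pc v ^+ 2) ^+ 3 by lra.
have e0 := eps_gt0 G; have e2 := eps2_gt0; have r0 := rad2_gt0 v0.
apply: mulr_gt0.
  by rewrite invr_gt0 lt_min ltr01 divr_gt0.
apply: exprn_gt0; rewrite lt0r !addr_ge0 ?sqr_ge0// andbT.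
rewrite !paddr_eq0 ?addr_ge0 ?sqr_ge0// !sqrf_eq0.
(* If p = 0, its j-component puts the cutoff at 0 or 1. In the first case u = 0, which is excluded;
   in the second the real part is 1. *)
apply/negP => /andP[/andP[/eqP a0 /eqP b0]]; move: a0 b0; rewrite /pa /pb /pc.
rewrite mulf_eq0 subr_eq0 => a0 b0 /orP[/eqP c0|/eqP c1].
  move: a0 b0; rewrite c0 subr0 !mul1r add0r => a0 b0; move: r0.
  suff -> : rad2 v = 0 by rewrite ltxx.
  rewrite /radius2 -[v 0 0 - _](@divfK _ (eps G)) ?gt_eqF// -[v 0 1 - _](@divfK _ (eps G)) ?gt_eqF//.
  by rewrite a0 b0 !mul0r expr0n addr0.
by move: a0; rewrite -c1 subrr mul0r addr0 => /eqP; rewrite oner_eq0.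
Qed.

Lemma det_model_frame i v : dom1 G i v -> 0 < \det (model_frame i v).
Proof.
case: i => [[]|] /= dv.
- by rewrite det_mulmx det_shear mulr1 det_cmul !sqrrN w_unit ltr01.
- by rewrite det_shear ltr01.
- exact/det_collar_frame/collar_neq0.
Qed.

Lemma twisted_continuous b : continuous (twisted b).
Proof.
move=> v; apply: (@m3_continuous _ _ (fun=> 1) (fun=> 0) (fun=> 0)
  (fun w => - tm b w * derive1 f (w 0 1)) (fun=> 1) (fun=> 0) (fun=> 0) (fun=> 0) (fun=> 1));
  try exact: cstf_continuous.
have [j jE] : exists j, forall w : E, tm b w = w 0 j.
  by case: b; [exists 3|exists 2].
apply: (@expr_continuous _ _ (@prof_derivable R G)
  (Mul (Mul (Cst (-1)) (Coord j)) (Der 1 (Coord 1)))) => // w.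
by rewrite /= jE mulN1r.
Qed.

Lemma coord_sub_continuous i (q k : R) v : {for v, continuous (fun v : E => (v 0 i - q) / k)}.
Proof.
by apply: (@expr_continuous _ _ (@prof_derivable R G)
  (Mul (Add (Coord i) (Cst (- q))) (Cst k^-1))).
Qed.

Lemma cutoff_continuous v : {for v, continuous cutoff}.
Proof.
have c1 := mulf_continuous (addf_continuous (@rad2_continuous _ G v)
  (@cstf_continuous R E (- inner_rad) v)) (@cstf_continuous R E (outer_rad - inner_rad)^-1 v).
exact: (continuous_max (@cstf_continuous R E 0 v) (continuous_min (@cstf_continuous R E 1 v) c1)).
Qed.

Lemma mu_continuous v : rad2 v != 0 -> {for v, continuous mu}.
Proof.
move=> v0; apply: (@continuousV _ _ (fun w => Num.min 1 (rad2 w / eps G ^+ 2))).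
  by rewrite gt_eqF// lt_min ltr01 divr_gt0 ?eps2_gt0 ?rad2_gt0.
have c1 := mulf_continuous (@rad2_continuous _ G v) (@cstf_continuous R E (eps G ^+ 2)^-1 v).
exact: (continuous_min (@cstf_continuous R E 1 v) c1).
Qed.

Lemma one_sub_cutoff_continuous v : {for v, continuous (fun v => 1 - cutoff v)}.
Proof.
exact: (addf_continuous (@cstf_continuous R E 1 v) (oppf_continuous (@cutoff_continuous v))).
Qed.

Lemma pa_continuous v : {for v, continuous pa}.
Proof.
exact: (addf_continuous (@cutoff_continuous v) (mulf_continuous
  (@one_sub_cutoff_continuous v) (@coord_sub_continuous 0 (q1 G) (eps G) v))).
Qed.

Lemma pb_continuous v : {for v, continuous pb}.
Proof.
exact: (mulf_continuous (@one_sub_cutoff_continuous v)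
  (@coord_sub_continuous 1 (q2 G) (eps G) v)).
Qed.

Lemma pc_continuous v : {for v, continuous pc}.
Proof. exact: (mulf_continuous (@cutoff_continuous v) (@one_sub_cutoff_continuous v)). Qed.

Lemma collar_frame_continuous v : rad2 v != 0 -> {for v, continuous collar_frame}.
Proof.
move=> v0; have cm := mu_continuous v0.
have a2 := sqrf_continuous (@pa_continuous v); have b2 := sqrf_continuous (@pb_continuous v).
have c2 := sqrf_continuous (@pc_continuous v).
have dbl (g : E -> R) : {for v, continuous g} -> {for v, continuous (fun v => 2 * g v)}.
  by move=> cg; exact: (mulf_continuous (@cstf_continuous R E 2 v) cg).
have ab := mulf_continuous (dbl _ (@pa_continuous v)) (@pb_continuous v).
have ac := mulf_continuous (dbl _ (@pa_continuous v)) (@pc_continuous v).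
have bc := mulf_continuous (dbl _ (@pb_continuous v)) (@pc_continuous v).
have nb2 := oppf_continuous b2; have nc2 := oppf_continuous c2.
exact: (m3_continuous (addf_continuous (addf_continuous a2 nb2) nc2) ab ac
  (oppf_continuous ab) (addf_continuous (addf_continuous a2 nb2) c2) (oppf_continuous bc)
  (mulf_continuous (oppf_continuous ac) cm) (mulf_continuous (oppf_continuous bc) cm)
  (mulf_continuous (addf_continuous (addf_continuous a2 b2) nc2) cm)).
Qed.

Lemma model_frame_continuous i v : dom1 G i v -> {for v, continuous (model_frame i)}.
Proof.
case: i => [[]|] /= dv.
- apply: (@mulmx_continuous _ _ (fun=> cmul (- w1 G) (- w2 G)) (twisted true)).
    by apply/mx_continuousP => i j; exact: cstf_continuous.
  exact: twisted_continuous.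
- exact: twisted_continuous.
- exact/collar_frame_continuous/collar_neq0.
Qed.

Lemma tm_deck b c a v : tm b (deck G c a v) = tm b v + tm b a.
Proof. by rewrite /tm /deck; case: b; rewrite quatE. Qed.

(** As the derivative of [f] is periodic, raising [tm b] by [tm b a] changes the frame by exactly
    the shear of the deck transformation. *)
Lemma twisted_deck b a v : intv a ->
  twisted b (deck G b a v) = twisted b v *m 'J (deck G b a) v.
Proof.
move=> ia; rewrite /twisted; transitivity (shear (- (tm b v + tm b a) * derive1 f (v 0 1))).
  by rewrite tm_deck /deck quatE derive1_prof_int.
rewrite jacobian_deck shear_mul; congr shear; lra.
Qed.

Lemma twisted_nearD b v : near_disc (al G) (be G) (q1 G) v -> twisted b v = 1%:M.
Proof. by move=> nv; rewrite /twisted nearD_derive1// mulr0 shear0. Qed.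

Lemma off1_collar v : dom G None v -> off G (eps1 G) v -> outer_rad < rad2 v.
Proof.
move=> cv ov; have e1 := ltW (eps1_gt0 G).
by apply/(nearD_off (lexx _) e1 cv.2.1).
Qed.

Lemma eps1_range : 0 <= eps1 G <= eps1 G.
Proof. by rewrite lexx ltW ?eps1_gt0. Qed.

Lemma collar_frame_xy (v w : E) : v 0 0 = w 0 0 -> v 0 1 = w 0 1 ->
  collar_frame v = collar_frame w.
Proof.
move=> e0 e1; rewrite /collar_frame /pa /pb /pc /mu /cutoff.
by rewrite (rad2_xy G e0 e1) e0 e1.
Qed.

(* The rotation [u^2] and the derivative [- eps^2 w / u^2] of the inversion cancel. *)
Lemma collar_frame_inv v : rad2 v != 0 -> rad2 v < inner_rad ->
  collar_frame v *m 'J inv v = cmul (- w1 G) (- w2 G).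
Proof.
move=> v0 vi; rewrite (collar_frame_inner v0 vi) (jacobian_inv v0) /=.
rewrite cmul_mul; set d := v 0 0 - q1 G; set e := v 0 1 - q2 G.
have X : (eps G ^+ 2)^-1 * eps G ^+ 2 = 1 by rewrite mulVf// gt_eqF// eps2_gt0.
have Y : (rad2 v)^-1 * (d ^+ 2 + e ^+ 2) = 1 by rewrite mulVf.
have -> : (rad2 v ^+ 2)^-1 = (rad2 v)^-1 * (rad2 v)^-1 by rewrite [rad2 v ^+ 2]expr2 invfM.
move: X Y; set s := (eps G ^+ 2)^-1; set r := (rad2 v)^-1 => X Y.
congr cmul.
- transitivity (- w1 G * (s * eps G ^+ 2) * (r * (d ^+ 2 + e ^+ 2)) ^+ 2); first lra.
  by rewrite X Y expr1n !mulr1.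
- transitivity (- w2 G * (s * eps G ^+ 2) * (r * (d ^+ 2 + e ^+ 2)) ^+ 2); first lra.
  by rewrite X Y expr1n !mulr1.
Qed.

End FrameModel.

(** * Descent of the model frames to the glued manifold *)

Section GlobalFrame.
Variables (R : realType) (G : setup R).
Local Notation E := 'rV[R]_4.
Local Notation f := (prof G).
Local Notation rad2 := (radius2 (q1 G) (q2 G)).
Local Notation inv := (invert (q1 G) (q2 G) (eps G) (w1 G) (w2 G)).
Local Notation M := (glued f (q1 G) (q2 G) (eps G) (w1 G) (w2 G)).
Local Notation A := (glued_atlas f (al G) (be G) (q1 G) (q2 G) (eps G) (w1 G) (w2 G)).
Local Notation frm := (model_frame G).
Local Notation pch := (pchart G).

Lemma model_frame_deck b a v : intv a ->
  frm (Some b) (deck G b a v) = frm (Some b) v *m 'J (deck G b a) v.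
Proof.
move=> ia; have T := @twisted_deck R G b a v ia.
case: b T => T; last exact: T.
by rewrite /model_frame T mulmxA.
Qed.

(** The last condition discards changes from a piece into the collar, which follow from the opposite
    ones. A collar point that meets a piece within [dom1] lies beyond [outer_rad] or inside
    [inner_rad], where the cutoff is constant and the frames match exactly. *)
Lemma model_frame_adm i j g v : adm G i j g -> dom1 G i v -> dom1 G j (g v) ->
  (j = None -> i = None) -> frm j (g v) = frm i v *m 'J g v.
Proof.
case=> {i j g} [b a|a|a|a|a|a] ia.
- by move=> _ _ _; exact: model_frame_deck.
- by move=> _ _ /(_ erefl).
- move=> cv dw _; have dv : off G (eps1 G) v := Gam_off (eps1_range G) (Gam_sym (Gam_deck G false v ia)) dw.
  rewrite [frm None v](collar_frame_outer (off1_collar cv dv)) mul1mx model_frame_deck//.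
  by rewrite [frm _ v](twisted_nearD false cv.2.1) mul1mx.
- by move=> _ _ /(_ erefl).
- move=> cv dw _; have v0 := collar_neq0 cv.
  have dv : off G (eps1 G) (inv v).
    exact: Gam_off (eps1_range G) (Gam_sym (Gam_deck G true (inv v) ia)) dw.
  have vi : rad2 v < inner_rad G.
    have := off1_collar (collar_inv cv) dv.
    rewrite /inner_rad ltr_pdivlMr ?outer_gt0// -(rad2_inv_mul v0) [rad2 (inv v) * _]mulrC.
    by rewrite ltr_pM2l// rad2_gt0.
  transitivity (frm None v *m ('J inv v *m 'J (deck G true a) (inv v))); last first.
    congr (_ *m _); symmetry; apply: jacobian_comp; last exact: deck_differentiable.
    exact: inv_differentiable.
  rewrite mulmxA [frm None v *m _](collar_frame_inv v0 vi).
  rewrite [LHS](model_frame_deck true (inv v) ia); congr (_ *m _).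
  rewrite /model_frame (twisted_nearD true (collar_inv cv).2.1).
  exact: mulmx1.
- move=> a0 a1 cv cw _.
  have fv := nearD_f cv.2.1.
  rewrite [frm None _](@collar_frame_xy _ G _ v); first last.
  + by rewrite /deck quatE a1 addr0.
  + by rewrite /deck quatE a0 addr0 fv mulr0 subr0.
  transitivity (frm None v *m (1%:M : 'M[R]_4)); first by rewrite mulmx1.
  by congr (_ *m _); rewrite jacobian_deck (nearD_derive1 cv.2.1) mulr0 shear0.
Qed.

Lemma model_frame_transition d i j v w x : A d -> dom1 G i v -> dom1 G j w -> d.1 x ->
  d.2 x = sheet G i v -> sheet G i v = sheet G j w ->
  frm i v *m 'J (transition (pch i) d) v = frm j w *m 'J (transition (pch j) d) w.
Proof.
(* The equation is symmetric in the two lifts, so a collar lift may be taken as the first one. *)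
move=> Ad; wlog ij : i j v w / j = None -> i = None.
  move=> H dv dw dx e vw; case: i dv e vw => [b|] dv e vw; last exact: H.
  case: j dw vw => [c|] dw vw; first exact: H.
  by symmetry; apply: H => //; rewrite -vw.
move=> dv dw dx e vw; have dv0 := dom1_dom dv; have dw0 := dom1_dom dw.
have [g ag gv] := sheet_adm dv0 dw0 vw.
have [_ _ _ _] := pchart_transition Ad dv0 dx e.
have [dTw _ _ _] := pchart_transition Ad dw0 dx (etrans e vw).
have dgv : dom G j (g v) by rewrite gv.
have [B [oB Bv Cg]] := adm_smooth ag dv0 dgv.
have dg := smooth_differentiable Cg Bv.
have n : \forall y \near v, transition (pch i) d y = (transition (pch j) d \o g) y.
  have n := adm_near ag dv0 dgv; near=> y.
  have [_ _ gy] : [/\ dom G i y, dom G j (g y) & sheet G j (g y) = sheet G i y] by near: y.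
  by rewrite /= /transition /= gy.
rewrite -gv in dTw *.
have dc : differentiable (transition (pch j) d \o g) v by exact: differentiable_comp.
rewrite (model_frame_adm ag dv _ ij); last by rewrite gv.
rewrite -mulmxA; congr (_ *m _).
transitivity ('J (transition (pch j) d \o g) v); first exact: jacobian_near.
exact: jacobian_comp.
Unshelve. all: by end_near. Qed.

Definition lift (m : M) : option bool * E := 
  let: exist i h := cid (sheet_cover m) in (i, proj1_sig (cid h)).

Lemma liftP (m : M) : dom1 G (lift m).1 (lift m).2 /\ sheet G (lift m).1 (lift m).2 = m.
Proof. by rewrite /lift; case: cid => i h /=; exact: (proj2_sig (cid h)). Qed.

Definition global_frame (c : chart R M) (v : E) : 'M[R]_4 :=
  let: (i, w) := lift (c.2 v) in frm i w *m 'J (transition (pch i) c) w.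

(** [lift] is an arbitrary, possibly discontinuous choice. Since any lift gives the same matrix,
    continuity can be proved with one that varies continuously with the point. *)
Lemma global_frameE c v i w : A c -> c.1 v -> dom1 G i w -> sheet G i w = c.2 v ->
  global_frame c v = frm i w *m 'J (transition (pch i) c) w.
Proof.
move=> Ac cv dw wv; rewrite /global_frame; have := liftP (c.2 v).
case: (lift (c.2 v)) => j u /= [du uv].
by apply: (model_frame_transition Ac du dw cv) => //; rewrite uv.
Qed.

Lemma global_frame_det c v : A c -> c.1 v -> 0 < \det (global_frame c v).
Proof.
move=> Ac cv; have [i [w [dw wv]]] := sheet_cover (c.2 v).
rewrite (global_frameE Ac cv dw wv) det_mulmx mulr_gt0 ?det_model_frame//.
by have [] := pchart_transition Ac (dom1_dom dw) cv (esym wv).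
Qed.

Lemma global_frame_continuous c v : A c -> c.1 v -> {for v, continuous (global_frame c)}.
Proof.
move=> Ac cv; have [i [w [dw wv]]] := sheet_cover (c.2 v).
have [oc _ [k ck kE]] := atlas_sheet Ac.
have dv := ck v cv; have vw : sheet G k v = sheet G i w by rewrite wv kE.
have dw0 := dom1_dom dw.
have [g ag gv] := sheet_adm dv dw0 vw.
have dgv : dom G i (g v) by rewrite gv.
have [B [oB Bv Cg]] := adm_smooth ag dv dgv.
have cg : {for v, continuous g} := differentiable_continuous (smooth_differentiable Cg Bv).
have [_ _ _ [B' [h [oB' Bw Th Ch]]]] := pchart_transition Ac dw0 cv (esym wv).
have cJ : {for w, continuous (fun y => 'J (transition (pch i) c) y)}.
  apply: near_eq_continuous (smooth_jacobian_continuous oB' Ch Bw).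
  near=> y; have By : B' y by near: y; exact: open_nbhs_nbhs.
  apply: jacobian_near; last exact: smooth_differentiable Ch By.
  by near=> z; apply/Th/mem_set; near: z; exact: open_nbhs_nbhs.
have cF : {for w, continuous (fun y => frm i y *m 'J (transition (pch i) c) y)}.
  by apply: mulmx_continuous => //; exact: model_frame_continuous.
rewrite -gv in cF.
have cFg := continuous_comp cg cF.
apply: near_eq_continuous cFg.
have n1 : \forall y \near v, dom1 G i (g y).
  apply: cg; apply: open_nbhs_nbhs; split; first exact: dom1_open.
  by rewrite gv.
have n2 := adm_near ag dv dgv.
have n3 : \forall y \near v, c.1 y by exact: open_nbhs_nbhs.
near=> y; have cy : c.1 y by near: y.
have [_ _ gy] : [/\ dom G k y, dom G i (g y) & sheet G i (g y) = sheet G k y] by near: y.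
rewrite (@global_frameE c y i (g y)) ?kE//.
by near: y.
Unshelve. all: by end_near. Qed.

Lemma global_frame_transition c d v : A c -> A d -> overlap c d v ->
  global_frame d (transition c d v) = global_frame c v *m 'J (transition c d) v.
Proof.
move=> Ac Ad [cv [x dx xv]]; have [i [w [dw wv]]] := sheet_cover (c.2 v).
have [od jd _] := atlas_sheet Ad; have dw0 := dom1_dom dw.
have tx : transition c d v = x by exact: transition_unique.
rewrite tx (global_frameE Ac cv dw wv) (global_frameE Ad dx dw (etrans wv (esym xv))).
have [dT _ Tw _] := pchart_transition Ac dw0 cv (esym wv).
have [cS _] := transition_smooth Ac Ad.
have dS : differentiable (transition c d) v by apply: smooth_differentiable cS _; split=> //; exists x.
have [j [g [ag djv gw n]]] := transition_adm Ac dw0 cv (esym wv).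
have ne : \forall y \near w, transition (pch i) d y = (transition c d \o transition (pch i) c) y.
  near=> y.
  have [_ _ cE Ty] : [/\ dom G i y, c.1 (g y), c.2 (g y) = sheet G i y &
    transition (pch i) c y = g y] by near: y.
  by rewrite /= Ty /transition cE.
rewrite -mulmxA; congr (_ *m _); rewrite -Tw in dS *.
have dc : differentiable (transition c d \o transition (pch i) c) w by exact: differentiable_comp.
transitivity ('J (transition c d \o transition (pch i) c) w); first exact: jacobian_near.
exact: jacobian_comp.
Unshelve. all: by end_near. Qed.

End GlobalFrame.

(** * From a global frame to a spin structure *)

Section Spin.
Variable R : realType.
Local Notation E := 'rV[R]_4.

Lemma qmul1x (x : E) : qmul (quat 1 0 0 0) x = x.
Proof. by apply: rv4P; rewrite /qmul !quatE; lra. Qed.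

Lemma qmulx1 (x : E) : qmul x (quat 1 0 0 0) = x.
Proof. by apply: rv4P; rewrite /qmul !quatE; lra. Qed.

Lemma qconj1 : qconj (quat 1 0 0 0 : E) = quat 1 0 0 0.
Proof. by apply: rv4P; rewrite /qconj !quatE ?oppr0. Qed.

Lemma spin_cover1 : spin_cover (quat 1 0 0 0 : E, quat 1 0 0 0 : E) = 1%:M.
Proof.
rewrite /spin_cover /=; apply/matrixP => i j.
by rewrite [LHS]mxE qconj1 qmulx1 qmul1x !mxE eqxx eq_sym.
Qed.

Lemma parallelizable_spin (M : topologicalType) (A : set (chart R M)) e :
  frame_on A setT e -> has_spin_structure A.
Proof.
move=> fe; pose one : E := quat 1 0 0 0.
have one1 : \sum_(i < 4) one 0 i ^+ 2 = 1.
  rewrite !big_ord_recl big_ord0 !mxE /=; lra.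
exists unit, (fun=> setT), (fun=> e), (fun _ _ _ => (one, one)); split=> //.
- by split=> [_|m]; [exact: openT|exists tt].
- by move=> _ _; split=> //; apply: continuous_subspaceT => m; exact: cvg_cst.
- by move=> _ _ c v _ _ _ _; rewrite spin_cover1 mul1mx.
- by move=> *; rewrite /spin_mul /= qmul1x.
Qed.

End Spin.

Lemma glued_spin (R : realType) (G : setup R) : closed_spin_manifold
  (glued_atlas (prof G) (al G) (be G) (q1 G) (q2 G) (eps G) (w1 G) (w2 G)).
Proof.
split; first exact: glued_manifold.
apply: (@parallelizable_spin _ _ _ (@global_frame R G)); split.
- move=> c Ac; apply: continuous_in_subspaceT => v /set_mem[cv _].
  exact: global_frame_continuous.
- by move=> c v Ac cv _; exact: global_frame_det.
- by move=> c d v Ac Ad cdv _; exact: global_frame_transition.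
Qed.

Theorem mainTheorem2 (R : realType) (f : R -> R) (al be q1 q2 eps w1 w2 : R)
  (twist_f : twist_profile f al be)
  (eps_gt0 : 0 < eps)
  (disc_off_support : be - 1 < q2 - eps /\ q2 + eps < al)
  (reflection_w : w1 ^+ 2 + w2 ^+ 2 = 1) :
  closed_spin_manifold (glued_atlas f al be q1 q2 eps w1 w2).
Proof.
have [lo hi] := disc_off_support.
have [d [d0 dlo dhi]] : exists d, [/\ 0 < d, be - 1 < q2 - (eps + d) & q2 + (eps + d) < al].
  (* Half of the smaller of the two margins between the disc and the support of the twist; [eps + d]
     becomes the auxiliary radius. *)
  exists (Num.min (q2 - eps - (be - 1)) (al - (q2 + eps)) / 2).
  have [|] := leP (q2 - eps - (be - 1)) (al - (q2 + eps)) => *; split; lra.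
have ed : eps < eps + d by rewrite ltrDl.
exact: (glued_spin (@Setup R f al be q1 q2 eps (eps + d) w1 w2
  twist_f eps_gt0 ed dlo dhi reflection_w)).
Qed.
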